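(* Let $R \to A$ be a finite type homomorphism of commutative rings where $R$ is Noetherian. Let $H$ be an adequate bialgebra over $A$ (adequate is defined in the context). Let $C$ be a finitely generated, locally finite, commutative $H$-algebra. Then $C^H$ is a finitely generated $R$-algebra, and for every finite type $C$-module $M$ the $C^H$-module $M^H$ is finite.
   Context: Rings are associative with $1$. A bialgebra $H$ over a commutative ring $A$ is an $A$-module with a unital associative $A$-algebra structure ($A \to H$, $H \otimes_A H \to H$) and a coassociative comultiplication $\delta : H \to H \otimes_A H$ with counit $\epsilon : H \to A$, such that $\delta$ and $\epsilon$ are unital $A$-algebra maps ($H$ need be neither commutative nor cocommutative, and no antipode is required). $\text{Mod}_H$ is the category of left modules over the algebra $H$; for $H$-modules $M, N$ the $A$-module $M \otimes_A N$ is an $H$-module via $\delta$, and $A$ is an $H$-module via $\epsilon$. The invariants of an $H$-module $M$ are $M^H = \{m \in M \mid h \cdot m = \epsilon(h) m \text{ for all } h \in H\}$. An $H$-algebra is an $H$-module $C$ which is also an $A$-algebra such that the unit $A \to C$ and the multiplication $C \otimes_A C \to C$ are $H$-module homomorphisms; it is commutative if it is commutative as an algebra, and finitely generated if it is finitely generated as an $A$-algebra. Maps of $H$-algebras are $H$-linear $A$-algebra maps. A $C$-module here is an $H$-module $M$ with a left $C$-module structure whose action map $C \otimes_A M \to M$ is an $H$-module homomorphism; it is of finite type if it is finitely generated as a module over the ring $C$. An $H$-module is of finite type if it is a finitely generated $A$-module, and is locally finite if it is a filtered colimit of finite type $H$-modules. $H$ is adequate if for every surjection of commutative $H$-algebras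 $C \to D$ with $C$ locally finite, and any $f \in D^H$, there exist $n > 0$ and $g \in C^H$ such that $g \mapsto f^n$ in $D^H$. *)

(* Defs.v *)
From HB Require Import structures.
From mathcomp Require Import all_boot all_order all_algebra.
From mathcomp Require Import boolp.

Set Implicit Arguments.
Unset Strict Implicit.
Unset Printing Implicit Defensive.

Import GRing.Theory.
Local Open Scope ring_scope.
Local Open Scope quotient_scope.

(* MathComp's algType excludes the zero ring, and Hierarchy Builder rejects any
   other structure inheriting from both pzRingType and lmodType.  An A-algebra
   is therefore a (possibly zero) ring B with a ring morphism from A to the
   centre of B, and its A-module structure is carried by the copy alg_amod B. *)
HB.mixin Record isPzAlgebra (A : comPzRingType) B of GRing.PzRing B := {
  alg_in : {rmorphism A -> B};
  alg_in_comm : forall (a : A) (b : B), alg_in a * b = b * alg_in a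
}.

#[short(type="pzAlgType")]
HB.structure Definition PzAlgebra (A : comPzRingType) :=
  {B of GRing.PzRing B & isPzAlgebra A B}.

Definition alg_amod (A : comPzRingType) (B : pzAlgType A) : Type := B.

Section AlgebraAsModule.
Variables (A : comPzRingType) (B : pzAlgType A).

Let scale (a : A) (b : B) : B := alg_in a * b.

Fact alg_scaleA a b x : scale a (scale b x) = scale (a * b) x.
Proof. by rewrite /scale rmorphM mulrA. Qed.

Fact alg_scale1 : left_id 1 scale.
Proof. by move=> x; rewrite /scale rmorph1 mul1r. Qed.

Fact alg_scaleDr : right_distributive scale +%R.
Proof. by move=> a x y; apply: mulrDr. Qed.

Fact alg_scaleDl x : {morph scale^~ x : a b / a + b}.
Proof. by move=> a b; rewrite /scale rmorphD mulrDl. Qed.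

HB.instance Definition _ := GRing.PzRing.copy (alg_amod B) B.
HB.instance Definition _ := GRing.Zmodule_isLmodule.Build A (alg_amod B)
  alg_scaleA alg_scale1 alg_scaleDr alg_scaleDl.

End AlgebraAsModule.

Definition is_ideal (R : comPzRingType) (I : R -> Prop) : Prop :=
  [/\ I 0, forall x y, I x -> I y -> I (x + y) & forall r x, I x -> I (r * x)].

Definition noetherian (R : comPzRingType) : Prop :=
  forall I : R -> Prop, is_ideal I ->
    exists s : seq R, forall x, I x <->
      exists c : nat -> R, x = \sum_(i < size s) c i * s`_i.

Definition finite_module (B : pzRingType) (V : lmodType B) : Prop :=
  exists s : seq V, forall v, exists c : nat -> B,
    v = \sum_(i < size s) c i *: s`_i.

(* The subring of B generated by the image of f and by s. *)
Inductive gen_subalg (R B : pzRingType) (f : {rmorphism R -> B}) (s : seq B) :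
    B -> Prop :=
| gen_scalar r : gen_subalg f s (f r)
| gen_mem x : x \in s -> gen_subalg f s x
| gen_sub x y : gen_subalg f s x -> gen_subalg f s y -> gen_subalg f s (x - y)
| gen_mul x y : gen_subalg f s x -> gen_subalg f s y -> gen_subalg f s (x * y).

Definition finite_type (R B : comPzRingType) (f : {rmorphism R -> B}) : Prop :=
  exists s : seq B, forall b, gen_subalg f s b.

Section Tensor.
Variables (A : comPzRingType) (M N : lmodType A).

(* A sequence stands for the sum of the pure tensors of its entries. *)
Inductive tens_eq : seq (M * N) -> seq (M * N) -> Prop :=
| teq_refl s : tens_eq s s
| teq_sym s t : tens_eq s t -> tens_eq t s
| teq_trans s t u : tens_eq s t -> tens_eq t u -> tens_eq s u
| teq_cat s s' t t' :
    tens_eq s s' -> tens_eq t t' -> tens_eq (s ++ t) (s' ++ t')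
| teq_swap s t : tens_eq (s ++ t) (t ++ s)
| teq_zero n : tens_eq [:: (0, n)] [::]
| teq_addl m m' n : tens_eq [:: (m + m', n)] [:: (m, n); (m', n)]
| teq_addr m n n' : tens_eq [:: (m, n + n')] [:: (m, n); (m, n')]
| teq_scale a m n : tens_eq [:: (a *: m, n)] [:: (m, a *: n)].

Definition tens_rel : rel (seq (M * N)) := fun s t => `[< tens_eq s t >].

Fact tens_rel_equiv : equiv_class_of tens_rel.
Proof.
split=> [s|s t|t s u]; first exact/asboolP/teq_refl.
  by apply/asboolP/asboolP; exact: teq_sym.
by move=> /asboolP st /asboolP tu; apply/asboolP; exact: teq_trans st tu.
Qed.

Canonical tens_equiv := EquivRelPack tens_rel_equiv.

Definition tens : Type := {eq_quot tens_equiv}.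
HB.instance Definition _ := EqQuotient.on tens.
HB.instance Definition _ := Choice.on tens.

Let pi (s : seq (M * N)) : tens := \pi_tens s.

Let piP s t : pi s = pi t <-> tens_eq s t.
Proof.
split=> [/eqmodP/asboolP//|st]; apply/eqmodP; exact/asboolP.
Qed.

Let reprP s : tens_eq (repr (pi s)) s.
Proof. by apply/piP; rewrite /pi reprK. Qed.

Let piK (x : tens) : pi (repr x) = x.
Proof. exact: reprK. Qed.

Definition tens_zero : tens := pi [::].
Definition tens_add (x y : tens) : tens := pi (repr x ++ repr y).
Definition tens_map1 (f : M -> M) (x : tens) : tens :=
  pi [seq (f p.1, p.2) | p <- repr x].

Let addE s t : tens_add (pi s) (pi t) = pi (s ++ t).
Proof. by apply/piP/teq_cat; apply: reprP. Qed.

Let map1_eq (f : {linear M -> M}) s t : tens_eq s t ->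
  tens_eq [seq (f p.1, p.2) | p <- s] [seq (f p.1, p.2) | p <- t].
Proof.
elim=> {s t} /=.
- by move=> s; apply: teq_refl.
- by move=> s t _; apply: teq_sym.
- by move=> s t u _ + _; apply: teq_trans.
- by move=> s s' t t' _ + _; rewrite !map_cat; apply: teq_cat.
- by move=> s t; rewrite !map_cat; apply: teq_swap.
- by move=> n; rewrite raddf0; apply: teq_zero.
- by move=> m m' n; rewrite raddfD; apply: teq_addl.
- by move=> m n n'; apply: teq_addr.
- by move=> a m n; rewrite linearZ; apply: teq_scale.
Qed.

Let map1E (f : {linear M -> M}) s :
  tens_map1 f (pi s) = pi [seq (f p.1, p.2) | p <- s].
Proof. by apply/piP/map1_eq/reprP. Qed.

Fact tens_addA : associative tens_add.
Proof.
move=> x y z; rewrite -(piK x) -(piK y) -(piK z) !addE catA //.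
Qed.

Fact tens_addC : commutative tens_add.
Proof. by move=> x y; apply/piP/teq_swap. Qed.

Fact tens_add0 : left_id tens_zero tens_add.
Proof. by move=> x; rewrite -(piK x) addE. Qed.

Fact tens_addN : left_inverse tens_zero (tens_map1 -%R) tens_add.
Proof.
move=> x; rewrite -(piK x) map1E addE; apply/piP.
elim: (repr x) => [|[m n] s IH] /=; first exact: teq_refl.
rewrite -cat1s -[(m, n) :: s]cat1s.
apply: teq_trans (_ : tens_eq (([:: (- m, n)] ++ [:: (m, n)]) ++
   ([seq (- p.1, p.2) | p <- s] ++ s)) _).
  rewrite -!catA; apply: teq_cat; first exact: teq_refl.
  rewrite !catA; apply: teq_cat; last exact: teq_refl.
  exact: teq_swap.
rewrite -[[::]]cats0; apply: teq_cat IH.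
apply: teq_trans (teq_zero n); rewrite -(addNr m).
exact/teq_sym/teq_addl.
Qed.

HB.instance Definition _ :=
  GRing.isZmodule.Build tens tens_addA tens_addC tens_add0 tens_addN.

Let piD s t : pi s + pi t = pi (s ++ t).
Proof. exact: addE. Qed.

Let tens_scale (a : A) : tens -> tens := tens_map1 ( *:%R a).

Fact tens_scalerA a b x : tens_scale a (tens_scale b x) = tens_scale (a * b) x.
Proof.
rewrite /tens_scale -(piK x) (map1E ( *:%R b)) !map1E -map_comp; congr pi.
by elim: (repr x) => //= -[m n] s ->; rewrite /= scalerA.
Qed.

Fact tens_scale1 : left_id 1 tens_scale.
Proof.
move=> x; rewrite /tens_scale -[in LHS](piK x) map1E -[RHS]piK; congr pi.
by elim: (repr x) => //= -[m n] s ->; rewrite /= scale1r.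
Qed.

Fact tens_scaleDr : right_distributive tens_scale +%R.
Proof.
move=> a x y; rewrite /tens_scale -(piK x) -(piK y) piD !map1E piD.
by rewrite map_cat.
Qed.

Let teq_cons2 p q r s t u : tens_eq [:: p] [:: q; r] -> tens_eq s (t ++ u) ->
  tens_eq (p :: s) ((q :: t) ++ (r :: u)).
Proof.
move=> pqr stu; apply: teq_trans (teq_cat pqr stu) _.
rewrite -[[:: q; r]]/([:: q] ++ [:: r]) -catA.
apply: (@teq_cat [:: q] [:: q]); first exact: teq_refl.
have := teq_cat (teq_swap [:: r] t) (teq_refl u).
by rewrite -!catA.
Qed.

Fact tens_scaleDl x : {morph tens_scale^~ x : a b / a + b}.
Proof.
move=> a b; rewrite /tens_scale -(piK x) !map1E piD; apply/piP.
elim: (repr x) => [|[m n] s IH] /=; first exact: teq_refl.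
by apply: teq_cons2 IH; rewrite scalerDl; apply: teq_addl.
Qed.

HB.instance Definition _ := GRing.Zmodule_isLmodule.Build A tens
  tens_scalerA tens_scale1 tens_scaleDr tens_scaleDl.

Definition tpure (m : M) (n : N) : tens := pi [:: (m, n)].

Lemma tpureDl m m' n : tpure (m + m') n = tpure m n + tpure m' n.
Proof. by rewrite piD; apply/piP/teq_addl. Qed.

Lemma tpureDr m n n' : tpure m (n + n') = tpure m n + tpure m n'.
Proof. by rewrite piD; apply/piP/teq_addr. Qed.

Lemma tpureZl a m n : tpure (a *: m) n = a *: tpure m n.
Proof. by rewrite [RHS]map1E. Qed.

Lemma tpureZr a m n : tpure m (a *: n) = a *: tpure m n.
Proof. by rewrite -tpureZl; apply/piP/teq_sym/teq_scale. Qed.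

Lemma tens_ind (P : tens -> Prop) :
  P 0 -> (forall m n x, P x -> P (tpure m n + x)) -> forall x, P x.
Proof.
move=> P0 PD x; rewrite -(piK x); elim: (repr x) => [//|[m n] s IH].
by rewrite -cat1s -piD; apply: PD.
Qed.

Definition balanced (P : zmodType) (f : M -> N -> P) : Prop :=
  [/\ forall m m' n, f (m + m') n = f m n + f m' n,
      forall m n n', f m (n + n') = f m n + f m n' &
      forall a m n, f (a *: m) n = f m (a *: n)].

(* The map induced by f on the tensor product, characterised by tlift_pure and
   tliftD when f is balanced, and meaningless otherwise. *)
Definition tlift (P : zmodType) (f : M -> N -> P) (x : tens) : P :=
  \sum_(p <- repr x) f p.1 p.2.

Section Lift.
Variables (P : zmodType) (f : M -> N -> P).
Hypothesis f_bal : balanced f.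

Let tlift_pi s : tlift f (pi s) = \sum_(p <- s) f p.1 p.2.
Proof.
have [fDl fDr fZ] := f_bal.
have f0 n : f 0 n = 0 by apply: (@addrI _ (f 0 n)); rewrite -fDl !addr0.
rewrite /tlift; have := reprP s; move: (repr _) => t.
elim=> {s t} //=.
- by move=> s t u _ -> _ ->.
- by move=> s1 s2 t1 t2 _ E _ F; rewrite !big_cat /= E F.
- by move=> s t; rewrite !big_cat /= addrC.
- by move=> n; rewrite big_seq1 big_nil f0.
- by move=> m m' n; rewrite !big_cons !big_nil !addr0 fDl.
- by move=> m n n'; rewrite !big_cons !big_nil !addr0 fDr.
- by move=> a m n; rewrite !big_seq1 fZ.
Qed.

Lemma tlift_pure m n : tlift f (tpure m n) = f m n.
Proof. by rewrite tlift_pi big_seq1. Qed.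

Lemma tlift0 : tlift f 0 = 0.
Proof. by rewrite tlift_pi big_nil. Qed.

Lemma tliftD x y : tlift f (x + y) = tlift f x + tlift f y.
Proof.
by rewrite -(piK x) -(piK y) piD !tlift_pi big_cat.
Qed.

End Lift.

Lemma tliftZ (P : lmodType A) (f : M -> N -> P) : balanced f ->
  (forall a m n, f (a *: m) n = a *: f m n) ->
  forall a x, tlift f (a *: x) = a *: tlift f x.
Proof.
move=> fb fZ a; apply: tens_ind => [|m n x IH].
  by rewrite scaler0 !tlift0 // scaler0.
by rewrite scalerDr -tpureZl !tliftD // !tlift_pure // IH fZ scalerDr.
Qed.

Lemma eq_tlift (P : zmodType) (f g : M -> N -> P) : f =2 g -> tlift f =1 tlift g.
Proof. by move=> fg x; apply: eq_bigr => p _. Qed.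

Lemma tlift_addf (P : zmodType) (f g : M -> N -> P) x :
  tlift (fun m n => f m n + g m n) x = tlift f x + tlift g x.
Proof. exact: big_split. Qed.

End Tensor.

Notation "x '\ot' y" := (tpure x y) (at level 40, left associativity).

Definition tmap (A : comPzRingType) (M N M' N' : lmodType A)
    (f : M -> M') (g : N -> N') : tens M N -> tens M' N' :=
  tlift (fun m n => f m \ot g n).

Definition tassoc (A : comPzRingType) (M N P : lmodType A) :
    tens (tens M N) P -> tens M (tens N P) :=
  tlift (fun x p => tlift (fun m n => m \ot (n \ot p)) x).

Section TensorAlgebra.
Variables (A : comPzRingType) (B B' : pzAlgType A).

Local Notation T := (tens (alg_amod B) (alg_amod B')).
Local Notation pure := (@tpure A (alg_amod B) (alg_amod B')).
Implicit Types (x y z : T) (a c e : alg_amod B) (b d f : alg_amod B').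

Let scaleE (C : pzAlgType A) (k : A) (c : alg_amod C) : k *: c = alg_in k * c.
Proof. by []. Qed.

Definition tens_mul x y : T :=
  tlift (fun a b => tlift (fun c d => pure (a * c) (b * d)) y) x.

Let scalerAl (C : pzAlgType A) (k : A) (x y : alg_amod C) :
  (k *: x) * y = k *: (x * y).
Proof. by rewrite !scaleE mulrA. Qed.

Let scalerAr (C : pzAlgType A) (k : A) (x y : alg_amod C) :
  x * (k *: y) = k *: (x * y).
Proof. by rewrite !scaleE !mulrA (alg_in_comm k (x : C)). Qed.

Let mul_inner a b : balanced (fun c d => pure (a * c) (b * d)).
Proof.
split=> [c c' d|c d d'|k c d]; first by rewrite mulrDr tpureDl.
  by rewrite mulrDr tpureDr.
by rewrite !scalerAr tpureZl tpureZr.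
Qed.

Let mul_outer y : balanced (fun a b =>
  tlift (fun c d => pure (a * c) (b * d)) y).
Proof.
split=> [a a' b|a b b'|k a b].
- rewrite -tlift_addf; apply: eq_tlift => c d.
  by rewrite mulrDl tpureDl.
- rewrite -tlift_addf; apply: eq_tlift => c d.
  by rewrite mulrDl tpureDr.
- apply: eq_tlift => c d.
  by rewrite !scalerAl tpureZl tpureZr.
Qed.

Lemma tens_mul_pure a b c d :
  tens_mul (pure a b) (pure c d) = pure (a * c) (b * d).
Proof. by rewrite /tens_mul tlift_pure // tlift_pure. Qed.

Fact tens_mulDl : left_distributive tens_mul +%R.
Proof. by move=> x y z; rewrite /tens_mul tliftD. Qed.

Fact tens_mulDr : right_distributive tens_mul +%R.
Proof.
move=> x y z; rewrite /tens_mul -tlift_addf; apply: eq_tlift => a b.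
by rewrite tliftD.
Qed.

Let mul0x x : tens_mul 0 x = 0.
Proof. by rewrite /tens_mul tlift0. Qed.

Let mulx0 x : tens_mul x 0 = 0.
Proof. by apply: (@addrI _ (tens_mul x 0)); rewrite -tens_mulDr !addr0. Qed.

Fact tens_mulA : associative tens_mul.
Proof.
move=> x y z; elim/tens_ind: x => [|a b x IHx]; first by rewrite !mul0x.
rewrite !tens_mulDl IHx {IHx}; congr (_ + _).
elim/tens_ind: y => [|c d y IHy]; first by rewrite !(mul0x, mulx0).
rewrite !(tens_mulDl, tens_mulDr) IHy {IHy}; congr (_ + _).
elim/tens_ind: z => [|e f z IHz]; first by rewrite !mulx0.
by rewrite !tens_mulDr IHz !tens_mul_pure !mulrA.
Qed.

Fact tens_mul1x : left_id (pure 1 1) tens_mul.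
Proof.
elim/tens_ind => [|a b x IH]; first by rewrite mulx0.
by rewrite tens_mulDr IH tens_mul_pure !mul1r.
Qed.

Fact tens_mulx1 : right_id (pure 1 1) tens_mul.
Proof.
elim/tens_ind => [|a b x IH]; first by rewrite mul0x.
by rewrite tens_mulDl IH tens_mul_pure !mulr1.
Qed.

HB.instance Definition _ := GRing.Zmodule_isPzRing.Build T
  tens_mulA tens_mul1x tens_mulx1 tens_mulDl tens_mulDr.

Lemma tpureM a b c d : pure a b * pure c d = pure (a * c) (b * d).
Proof. exact: tens_mul_pure. Qed.

Let scale_mull (k : A) x y : (k *: x) * y = k *: (x * y).
Proof.
elim/tens_ind: x => [|a b x IHx]; first by rewrite scaler0 mul0r scaler0.
rewrite mulrDl !scalerDr mulrDl IHx {IHx}; congr (_ + _).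
elim/tens_ind: y => [|c d y IHy]; first by rewrite !(mulr0, scaler0).
rewrite !mulrDr scalerDr IHy {IHy} -tpureZl; congr (_ + _).
by rewrite !tpureM scalerAl tpureZl.
Qed.

Let scale_mulr (k : A) x y : x * (k *: y) = k *: (x * y).
Proof.
elim/tens_ind: y => [|c d y IHy]; first by rewrite !(mulr0, scaler0).
rewrite mulrDr !scalerDr mulrDr IHy {IHy}; congr (_ + _).
elim/tens_ind: x => [|a b x IHx]; first by rewrite !(mul0r, scaler0).
rewrite !mulrDl scalerDr IHx {IHx} -[in LHS]tpureZl; congr (_ + _).
by rewrite !tpureM scalerAr tpureZl.
Qed.

Definition tens_in (a : A) : T := a *: (1 : T).

Fact tens_in_zmod_morphism : zmod_morphism tens_in.
Proof. by move=> a b; rewrite /tens_in scalerBl. Qed.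

Fact tens_in_monoid_morphism : monoid_morphism tens_in.
Proof.
split=> [|a b]; rewrite /tens_in ?scale1r //.
by rewrite scale_mull mul1r scalerA.
Qed.

HB.instance Definition _ :=
  GRing.isZmodMorphism.Build A T tens_in tens_in_zmod_morphism.
HB.instance Definition _ :=
  GRing.isMonoidMorphism.Build A T tens_in tens_in_monoid_morphism.

Fact tens_in_comm (a : A) (x : T) : tens_in a * x = x * tens_in a.
Proof. by rewrite /tens_in scale_mull scale_mulr mul1r mulr1. Qed.

HB.instance Definition _ := isPzAlgebra.Build A T tens_in_comm.

End TensorAlgebra.

Record bialgebra (A : comPzRingType) := Bialgebra {
  bialg_sort :> pzAlgType A;
  delta : {rmorphism bialg_sort -> tens (alg_amod bialg_sort) (alg_amod bialg_sort)};
  eps : {rmorphism bialg_sort -> A};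
  delta_in : forall a : A, delta (alg_in a) = alg_in a;
  eps_in : forall a : A, eps (alg_in a) = a;
  delta_coassoc : forall h : alg_amod bialg_sort,
    tassoc (tmap (delta : alg_amod bialg_sort -> _) id (delta h)) =
    tmap id (delta : alg_amod bialg_sort -> _) (delta h);
  eps_counitl : forall h : alg_amod bialg_sort,
    tlift (fun g g' : alg_amod bialg_sort => eps g *: g') (delta h) = h;
  eps_counitr : forall h : alg_amod bialg_sort,
    tlift (fun g g' : alg_amod bialg_sort => eps g' *: g) (delta h) = h
}.

HB.mixin Record isHModule (A : comPzRingType) (H : bialgebra A) M
    of GRing.Zmodule M := {
  hact : H -> M -> M;
  hactA : forall (g h : H) (m : M), hact g (hact h m) = hact (g * h) m;
  hact1 : forall m : M, hact 1 m = m;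
  hactDl : forall (g h : H) (m : M), hact (g + h) m = hact g m + hact h m;
  hactDr : forall (h : H) (m m' : M), hact h (m + m') = hact h m + hact h m'
}.

#[short(type="hModType")]
HB.structure Definition HModule (A : comPzRingType) (H : bialgebra A) :=
  {M of GRing.Zmodule M & isHModule A H M}.

Definition hlinear (A : comPzRingType) (H : bialgebra A) (M N : hModType H)
    (f : M -> N) : Prop :=
  (forall m m' : M, f (m + m') = f m + f m') /\
  (forall (h : H) (m : M), f (hact h m) = hact h (f m)).

(* The A-module underlying M, by restriction of scalars along A -> H. *)
Definition hmod_amod (A : comPzRingType) (H : bialgebra A) (M : hModType H) :
  Type := M.

Section HModuleAsModule.
Variables (A : comPzRingType) (H : bialgebra A) (M : hModType H).

Let scale (a : A) (m : M) : M := hact (alg_in a : H) m.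

Fact hmod_scaleA a b m : scale a (scale b m) = scale (a * b) m.
Proof. by rewrite /scale hactA rmorphM. Qed.

Fact hmod_scale1 : left_id 1 scale.
Proof. by move=> m; rewrite /scale rmorph1 hact1. Qed.

Fact hmod_scaleDr : right_distributive scale +%R.
Proof. by move=> a m m'; apply: hactDr. Qed.

Fact hmod_scaleDl m : {morph scale^~ m : a b / a + b}.
Proof. by move=> a b; rewrite /scale rmorphD hactDl. Qed.

HB.instance Definition _ := HModule.copy (hmod_amod M) M.
HB.instance Definition _ := GRing.Zmodule_isLmodule.Build A (hmod_amod M)
  hmod_scaleA hmod_scale1 hmod_scaleDr hmod_scaleDl.

Lemma hactZr (a : A) (h : H) (m : hmod_amod M) :
  hact h (a *: m : M) = a *: (hact h (m : M) : hmod_amod M).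
Proof. by rewrite [LHS]hactA -alg_in_comm -hactA. Qed.

Lemma hactZl (a : A) (h : alg_amod H) (m : hmod_amod M) :
  hact (a *: h : H) (m : M) = a *: (hact (h : H) (m : M) : hmod_amod M).
Proof. by rewrite [RHS]hactA. Qed.

Lemma hact0 (h : H) : hact h (0 : M) = 0.
Proof. by apply: (@addrI _ (hact h (0 : M))); rewrite -hactDr !addr0. Qed.

Lemma hactN (h : H) (m : M) : hact h (- m) = - hact h m.
Proof. by apply: (@addrI _ (hact h m)); rewrite -hactDr !subrr hact0. Qed.

End HModuleAsModule.

Section TrivialModule.
Variables (A : comPzRingType) (H : bialgebra A).

Let triv (h : H) (a : A^o) : A^o := eps H h * a.

Fact triv_actA g h a : triv g (triv h a) = triv (g * h) a.
Proof. by rewrite /triv rmorphM mulrA. Qed.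

Fact triv_act1 a : triv 1 a = a.
Proof. by rewrite /triv rmorph1 mul1r. Qed.

Fact triv_actDl g h a : triv (g + h) a = triv g a + triv h a.
Proof. by rewrite /triv rmorphD mulrDl. Qed.

Fact triv_actDr h a b : triv h (a + b) = triv h a + triv h b.
Proof. exact: mulrDr. Qed.

HB.instance Definition _ := isHModule.Build A H A^o
  triv_actA triv_act1 triv_actDl triv_actDr.

End TrivialModule.

Section TensorModule.
Variables (A : comPzRingType) (H : bialgebra A) (M N : hModType H).

Local Notation HH := (tens (alg_amod H) (alg_amod H)).
Local Notation MN := (tens (hmod_amod M) (hmod_amod N)).
Implicit Types (x y : HH) (t u : MN).

Let act (M' : hModType H) (h : alg_amod H) (m : hmod_amod M') :
  hmod_amod M' := hact (h : H) m.

Definition tens_act2 x t : MN :=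
  tlift (fun g g' => tmap (act (M' := M) g) (act (M' := N) g') t) x.

Let act_inner (g g' : alg_amod H) :
  balanced (fun (m : hmod_amod M) (n : hmod_amod N) => act g m \ot act g' n).
Proof.
split=> [m m' n|m n n'|a m n].
- by rewrite /act hactDr tpureDl.
- by rewrite /act hactDr tpureDr.
- by rewrite /act !hactZr tpureZl tpureZr.
Qed.

Let act_outer t : balanced (fun g g' : alg_amod H =>
  tmap (act (M' := M) g) (act (M' := N) g') t).
Proof.
split=> [g h g'|g g' h|a g g'].
- by rewrite /tmap -tlift_addf; apply: eq_tlift => m n; rewrite /act hactDl tpureDl.
- by rewrite /tmap -tlift_addf; apply: eq_tlift => m n; rewrite /act hactDl tpureDr.
- by apply: eq_tlift => m n; rewrite /act !hactZl tpureZl tpureZr.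
Qed.

Lemma tens_act2_pure (g g' : alg_amod H) (m : hmod_amod M) (n : hmod_amod N) :
  tens_act2 (g \ot g') (m \ot n) =
  (hact (g : H) (m : M) : hmod_amod M) \ot (hact (g' : H) (n : N) : hmod_amod N).
Proof. by rewrite /tens_act2 tlift_pure // /tmap tlift_pure. Qed.

Lemma tens_act2Dl x y t : tens_act2 (x + y) t = tens_act2 x t + tens_act2 y t.
Proof. by rewrite /tens_act2 tliftD. Qed.

Lemma tens_act2Dr x t u : tens_act2 x (t + u) = tens_act2 x t + tens_act2 x u.
Proof.
rewrite /tens_act2 -tlift_addf; apply: eq_tlift => g g'.
by rewrite /tmap tliftD.
Qed.

Lemma tens_act2_0x t : tens_act2 0 t = 0.
Proof. by rewrite /tens_act2 tlift0. Qed.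

Lemma tens_act2_x0 x : tens_act2 x 0 = 0.
Proof. by apply: (@addrI _ (tens_act2 x 0)); rewrite -tens_act2Dr !addr0. Qed.

Lemma tens_act2A x y t : tens_act2 x (tens_act2 y t) = tens_act2 (x * y) t.
Proof.
elim/tens_ind: x => [|g g' x IHx]; first by rewrite mul0r !tens_act2_0x.
rewrite mulrDl !tens_act2Dl IHx {IHx}; congr (_ + _).
elim/tens_ind: y => [|h h' y IHy].
  by rewrite mulr0 !tens_act2_0x tens_act2_x0.
rewrite mulrDr !tens_act2Dl tens_act2Dr IHy {IHy}; congr (_ + _).
rewrite tpureM.
elim/tens_ind: t => [|m n t IHt]; first by rewrite !tens_act2_x0.
by rewrite !tens_act2Dr IHt !tens_act2_pure !hactA.
Qed.

Definition tens_act (h : H) t : MN := tens_act2 (delta H h) t.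

Fact tens_actA g h t : tens_act g (tens_act h t) = tens_act (g * h) t.
Proof. by rewrite /tens_act tens_act2A rmorphM. Qed.

Fact tens_act1 t : tens_act 1 t = t.
Proof.
rewrite /tens_act rmorph1.
elim/tens_ind: t => [|m n t IHt]; first by rewrite tens_act2_x0.
by rewrite tens_act2Dr IHt tens_act2_pure !hact1.
Qed.

Fact tens_actDl g h t : tens_act (g + h) t = tens_act g t + tens_act h t.
Proof. by rewrite /tens_act rmorphD tens_act2Dl. Qed.

Fact tens_actDr h t u : tens_act h (t + u) = tens_act h t + tens_act h u.
Proof. exact: tens_act2Dr. Qed.

HB.instance Definition _ := isHModule.Build A H MN
  tens_actA tens_act1 tens_actDl tens_actDr.

End TensorModule.

(* The first axiom says that the two A-module structures of C agree. *)
HB.mixin Record isHAlgebra (A : comPzRingType) (H : bialgebra A) C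
    of HModule A H C & PzAlgebra A C := {
  hact_alg_in : forall (a : A) (c : C), hact (alg_in a : H) c = alg_in a * c;
  hunit_hlinear : hlinear (H := H) (fun a : A^o => alg_in (a : A) : C);
  hmul_hlinear :
    hlinear (H := H) (tlift (fun b c : hmod_amod C => (b : C) * (c : C)))
}.

#[short(type="hAlgType")]
HB.structure Definition HAlgebra (A : comPzRingType) (H : bialgebra A) :=
  {C of HModule A H C & PzAlgebra A C & isHAlgebra A H C}.

#[short(type="comHAlgType")]
HB.structure Definition ComHAlgebra (A : comPzRingType) (H : bialgebra A) :=
  {C of HAlgebra A H C & GRing.ComPzRing C}.

(* A-linearity follows from hlinear. *)
Definition halg_morphism (A : comPzRingType) (H : bialgebra A)
    (C D : hAlgType H) (f : C -> D) : Prop :=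
  hlinear f /\ monoid_morphism f.

(* The first axiom says that the two A-module structures of M agree. *)
HB.mixin Record isCModule (A : comPzRingType) (H : bialgebra A)
    (C : hAlgType H) M of GRing.Lmodule C M & HModule A H M := {
  hact_alg_in_scale : forall (a : A) (m : M),
    hact (alg_in a : H) m = (alg_in a : C) *: m;
  scale_hlinear :
    hlinear (H := H)
      (tlift (fun (c : hmod_amod C) (m : hmod_amod M) => (c : C) *: (m : M)))
}.

#[short(type="cModType")]
HB.structure Definition CModule (A : comPzRingType) (H : bialgebra A)
    (C : hAlgType H) :=
  {M of GRing.Lmodule C M & HModule A H M & isCModule A H C M}.

Definition is_invariant (A : comPzRingType) (H : bialgebra A) (M : hModType H) :
    {pred M} :=
  fun m => `[< forall h : H, hact h m = eps H h *: (m : hmod_amod M) >].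
Arguments is_invariant {A H} M.

Record invariants (A : comPzRingType) (H : bialgebra A) (M : hModType H) :=
  Invariant { inv_val :> M; inv_valP : inv_val \in is_invariant M }.

Section Invariants.
Variables (A : comPzRingType) (H : bialgebra A).

Lemma invariantP (M : hModType H) (m : M) :
  reflect (forall h : H, hact h m = eps H h *: (m : hmod_amod M))
    (m \in is_invariant M).
Proof. exact: asboolP. Qed.

HB.instance Definition _ (M : hModType H) := [isSub for @inv_val A H M].
HB.instance Definition _ (M : hModType H) := [Choice of invariants M by <:].

Fact invariant_zmod_closed (M : hModType H) : zmod_closed (is_invariant M).
Proof.
split=> [|m n /invariantP Im /invariantP In]; apply/invariantP => h.
  by rewrite hact0 scaler0.
by rewrite hactDr hactN Im In scalerBr.
Qed.

HB.instance Definition _ (M : hModType H) :=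
  GRing.SubChoice_isSubZmodule.Build M (is_invariant M) (invariants M)
    (invariant_zmod_closed M).

Let eps_eps (h : H) :
  tlift (fun g g' : alg_amod H => eps H g * eps H g') (delta H h) = eps H h.
Proof.
rewrite -[in RHS](eps_counitl (h : alg_amod H)).
rewrite /tlift raddf_sum; apply: eq_bigr => -[g g'] _ /=.
by rewrite rmorphM eps_in.
Qed.

Let tens_act_inv (M N : hModType H) (P : lmodType A)
    (f : hmod_amod M -> hmod_amod N -> P) (h : H)
    (m : hmod_amod M) (n : hmod_amod N) :
  balanced f -> (forall a m n, f (a *: m) n = a *: f m n) ->
  (m : M) \in is_invariant M -> (n : N) \in is_invariant N ->
  tlift f (tens_act h (m \ot n)) = eps H h *: f m n.
Proof.
move=> fb fZ /invariantP Im /invariantP In; rewrite -eps_eps /tens_act.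
have eb : balanced (fun g g' : alg_amod H => eps H g * eps H g').
  split=> [g k g'|g g' k|a g g']; rewrite ?rmorphD ?mulrDl ?mulrDr //.
  have epsZ (k : alg_amod H) : eps H (a *: k : alg_amod H) = a * eps H k.
    by rewrite rmorphM eps_in.
  by rewrite !epsZ mulrCA mulrA.
elim/tens_ind: (delta H h) => [|g g' x IH].
  by rewrite tens_act2_0x !tlift0 // scale0r.
rewrite tens_act2Dl !tliftD // IH scalerDl; congr (_ + _).
rewrite tens_act2_pure !tlift_pure // Im In -scalerA fZ; congr (_ *: _).
by have [_ _ <-] := fb; rewrite fZ.
Qed.

Section Ring.
Variable C : hAlgType H.

Let scaleE (a : A) (c : hmod_amod C) : a *: c = (alg_in a : C) * (c : C).
Proof. exact: hact_alg_in. Qed.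

Fact invariant_alg_in (a : A) : (alg_in a : C) \in is_invariant C.
Proof.
apply/invariantP => h; have [_ E] := @hunit_hlinear A H C.
by rewrite -[LHS]E scaleE -rmorphM.
Qed.

Fact invariant_subring_closed : subring_closed (is_invariant C).
Proof.
have [inv0 invB] := invariant_zmod_closed C.
split=> [||b c Ib Ic]; first by rewrite -(rmorph1 alg_in) invariant_alg_in.
  exact: invB.
have mb : balanced (fun b c : hmod_amod C => (b : C) * (c : C) : hmod_amod C).
  split=> [x y z|x y z|a x y]; rewrite ?mulrDl ?mulrDr //.
  by rewrite !scaleE mulrA -(alg_in_comm a (x : C)).
have mZ (a : A) (x y : hmod_amod C) :
    ((a *: x : hmod_amod C) : C) * y = a *: ((x : C) * y : hmod_amod C).
  by rewrite !scaleE mulrA.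
apply/invariantP => h.
have [_ /(_ h ((b : hmod_amod C) \ot (c : hmod_amod C)))] := @hmul_hlinear A H C.
rewrite [X in _ = hact h X -> _](tlift_pure mb) => <-.
exact: (tens_act_inv h mb mZ Ib Ic).
Qed.

End Ring.

HB.instance Definition _ (C : hAlgType H) :=
  GRing.SubZmodule_isSubPzRing.Build C (is_invariant C) (invariants C)
    (invariant_subring_closed C).

Fact invariant_mulrC (C : comHAlgType H) :
  commutative (fun b c : invariants C => b * c).
Proof. by move=> b c; apply: val_inj; rewrite /= mulrC. Qed.

HB.instance Definition _ (C : comHAlgType H) :=
  GRing.PzRing_hasCommutativeMul.Build (invariants C) (@invariant_mulrC C).

Definition inv_alg_in (C : hAlgType H) (a : A) : invariants C :=
  Invariant (invariant_alg_in C a).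

Fact inv_alg_in_zmod_morphism (C : hAlgType H) :
  zmod_morphism (@inv_alg_in C).
Proof. by move=> a b; apply: val_inj; rewrite /= rmorphB. Qed.

Fact inv_alg_in_monoid_morphism (C : hAlgType H) :
  monoid_morphism (@inv_alg_in C).
Proof.
split=> [|a b]; apply: val_inj; first by rewrite /= rmorph1.
by rewrite /= rmorphM.
Qed.

HB.instance Definition _ (C : hAlgType H) :=
  GRing.isZmodMorphism.Build A (invariants C) (@inv_alg_in C)
    (@inv_alg_in_zmod_morphism C).
HB.instance Definition _ (C : hAlgType H) :=
  GRing.isMonoidMorphism.Build A (invariants C) (@inv_alg_in C)
    (@inv_alg_in_monoid_morphism C).

Section Module.
Variables (C : hAlgType H) (M : cModType C).

Fact invariant_scale (c : C) (m : M) :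
  c \in is_invariant C -> m \in is_invariant M -> c *: m \in is_invariant M.
Proof.
move=> Ic Im.
have scaleE (a : A) (x : hmod_amod M) : a *: x = (alg_in a : C) *: (x : M).
  exact: hact_alg_in_scale.
have scaleCE (a : A) (x : hmod_amod C) : a *: x = (alg_in a : C) * (x : C).
  exact: hact_alg_in.
have mb : balanced
    (fun (b : hmod_amod C) (x : hmod_amod M) => (b : C) *: (x : M) : hmod_amod M).
  split=> [x y z|x y z|a x y]; rewrite ?scalerDl ?scalerDr //.
  by rewrite scaleE scaleCE scalerA (alg_in_comm a (x : C)).
have mZ (a : A) (x : hmod_amod C) (y : hmod_amod M) :
    ((a *: x : hmod_amod C) : C) *: (y : M)
      = a *: ((x : C) *: (y : M) : hmod_amod M).
  by rewrite scaleE scaleCE scalerA.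
apply/invariantP => h.
have [_ /(_ h ((c : hmod_amod C) \ot (m : hmod_amod M)))] :=
  @scale_hlinear A H C M.
rewrite [X in _ = hact h X -> _](tlift_pure mb) => <-.
exact: (tens_act_inv h mb mZ Ic Im).
Qed.

Definition inv_scale (c : invariants C) (m : invariants M) : invariants M :=
  Invariant (invariant_scale (inv_valP c) (inv_valP m)).

Fact inv_scaleA b c m : inv_scale b (inv_scale c m) = inv_scale (b * c) m.
Proof. by apply: val_inj; rewrite /= scalerA. Qed.

Fact inv_scale1 : left_id 1 inv_scale.
Proof. by move=> m; apply: val_inj; rewrite /= scale1r. Qed.

Fact inv_scaleDr : right_distributive inv_scale +%R.
Proof. by move=> c m n; apply: val_inj; rewrite /= scalerDr. Qed.

Fact inv_scaleDl m : {morph inv_scale^~ m : b c / b + c}.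
Proof. by move=> b c; apply: val_inj; rewrite /= scalerDl. Qed.

HB.instance Definition _ := GRing.Zmodule_isLmodule.Build (invariants C)
  (invariants M) inv_scaleA inv_scale1 inv_scaleDr inv_scaleDl.

End Module.
End Invariants.

Definition finite_hmodule (A : comPzRingType) (H : bialgebra A)
    (M : hModType H) : Prop :=
  finite_module (hmod_amod M).

Record category := Category {
  obj :> Type;
  hom : obj -> obj -> Type;
  idm : forall i, hom i i;
  comp : forall i j k, hom j k -> hom i j -> hom i k;
  comp1m : forall i j (u : hom i j), comp (idm j) u = u;
  compm1 : forall i j (u : hom i j), comp u (idm i) = u;
  compA : forall i j k l (w : hom k l) (v : hom j k) (u : hom i j),
    comp w (comp v u) = comp (comp w v) u
}.

Definition filtered (J : category) : Prop :=
  [/\ inhabited J,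
      forall i j : J, exists k, inhabited (hom i k) /\ inhabited (hom j k) &
      forall (i j : J) (u v : hom i j),
        exists k (w : hom j k), comp w u = comp w v].

Record diagram (A : comPzRingType) (H : bialgebra A) (J : category) := Diagram {
  dobj :> J -> hModType H;
  dmap : forall i j, hom i j -> dobj i -> dobj j;
  dmap_hlinear : forall i j (u : hom i j), hlinear (dmap u);
  dmap_idm : forall i (x : dobj i), dmap (idm i) x = x;
  dmap_comp : forall i j k (v : hom j k) (u : hom i j) (x : dobj i),
    dmap (comp v u) x = dmap v (dmap u x)
}.

Definition is_cocone (A : comPzRingType) (H : bialgebra A) (J : category)
    (D : diagram H J) (M : hModType H) (c : forall i, D i -> M) : Prop :=
  (forall i, hlinear (c i)) /\
  (forall i j (u : hom i j) (x : D i), c j (dmap u x) = c i x).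

Definition is_colimit (A : comPzRingType) (H : bialgebra A) (J : category)
    (D : diagram H J) (M : hModType H) (c : forall i, D i -> M) : Prop :=
  is_cocone c /\
  forall (N : hModType H) (d : forall i, D i -> N), is_cocone d ->
    exists! f : M -> N, hlinear f /\ forall i (x : D i), f (c i x) = d i x.

Definition locally_finite (A : comPzRingType) (H : bialgebra A)
    (M : hModType H) : Prop :=
  exists (J : category) (D : diagram H J) (c : forall i, D i -> M),
    [/\ filtered J, forall i, finite_hmodule (D i) & is_colimit c].

Definition adequate (A : comPzRingType) (H : bialgebra A) : Prop :=
  forall (C D : comHAlgType H) (p : C -> D),
    halg_morphism p -> (forall d, exists c, p c = d) -> locally_finite C ->
    forall f : invariants D, exists n (g : invariants C),
      (0 < n)%N /\ p (inv_val g) = inv_val f ^+ n.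

(* Main.v *)
(* The argument is Nagata's, arranged so that no finiteness of integral closures
   is needed. By local finiteness C is generated by the A-span V of finitely many
   elements, V being stable under H. Put F_n = V^n. The Rees algebra
   B = sum_n F_n t^n, a subalgebra of C[t], is a locally finite finitely generated
   H-algebra which is graded, with B_0 the image of A, and t = 1 maps B^H onto C^H.
   More generally (B/I)^H is a finitely generated R-algebra for every stable graded
   ideal I, by noetherian induction on I. If (B/I)^H is not concentrated in degree
   0, choose in it a nonzero homogeneous f of positive degree and let I1 = I + fB,
   I2 = (I : f). For I' = I1, I2 the ring (B/I')^H is finitely generated (for I2,
   only if I2 <> I), and by adequacy every element has a power in the image of B^H.
   As in the Artin-Tate lemma, (B/I')^H is then finite over a finitely generated
   subalgebra of that image, and so is the image of (B/I)^H. Since multiplication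
   by f identifies B/I2 with fB/I equivariantly, generators of (B/I)^H follow; if
   I2 = I, induction on the degree replaces the information on I2.
   For a module M, the submodule C M^H is generated by finitely many invariants;
   the quotients of the filtration by the first k of them are C/J with J stable,
   and (C/J)^H is finite over the noetherian ring C^H. *)
Require Import Defs.
From HB Require Import structures.
From mathcomp Require Import all_boot all_order all_algebra.
From mathcomp Require Import boolp.

Set Implicit Arguments.
Unset Strict Implicit.
Unset Printing Implicit Defensive.

Import GRing.Theory.
Local Open Scope ring_scope.

(** * Finite choice of witnesses and uniform bounds over lists *)

Lemma seq_exists (T U : eqType) (P : T -> U -> Prop) (s : seq T) :
  (forall x, x \in s -> exists y, P x y) ->
  exists t : seq U, (forall x, x \in s -> exists2 y, y \in t & P x y) /\
    (forall y, y \in t -> exists2 x, x \in s & P x y).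
Proof.
elim: s => [|x s IH] Ps; first by exists [::].
have [y Pxy] := Ps x (mem_head _ _).
have [z zs|t [st ts]] := IH; first by apply: Ps; rewrite in_cons zs orbT.
exists (y :: t); split=> z; rewrite in_cons => /predU1P[->|].
- by exists y; rewrite ?mem_head.
- by move=> /st[w wt Pzw]; exists w; rewrite // in_cons wt orbT.
- by exists x; rewrite ?mem_head.
- by move=> /ts[w ws Pwz]; exists w; rewrite // in_cons ws orbT.
Qed.

Lemma seq_bound (T : eqType) (P : nat -> T -> Prop) (s : seq T) :
  (forall m n x, (m <= n)%N -> P m x -> P n x) ->
  (forall x, x \in s -> exists n, P n x) ->
  exists n, forall x, x \in s -> P n x.
Proof.
move=> Pmono; elim: s => [|x s IH] Ps; first by exists 0%N.
have [m Pm] := Ps x (mem_head _ _).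
have [z zs|n Pn] := IH; first by apply: Ps; rewrite in_cons zs orbT.
exists (maxn m n) => z; rewrite in_cons => /predU1P[->|/Pn].
  exact: Pmono (leq_maxl _ _) Pm.
exact/Pmono/leq_maxr.
Qed.

(** * Noetherian modules and Hilbert's basis theorem *)

Definition is_subring (B : pzRingType) (S : B -> Prop) : Prop :=
  [/\ S 1, forall x y, S x -> S y -> S (x - y)
    & forall x y, S x -> S y -> S (x * y)].

Section Subring.
Variables (B : pzRingType) (S : B -> Prop).
Hypothesis S_ring : is_subring S.

Lemma subring1 : S 1. Proof. by case: S_ring. Qed.

Lemma subringB x y : S x -> S y -> S (x - y).
Proof. by case: S_ring => _ + _; apply. Qed.

Lemma subringM x y : S x -> S y -> S (x * y).
Proof. by case: S_ring => _ _; apply. Qed.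

Lemma subring0 : S 0.
Proof. by rewrite -(subrr 1); apply: subringB; apply: subring1. Qed.

Lemma subringN x : S x -> S (- x).
Proof. by move=> Sx; rewrite -sub0r; apply: subringB => //; apply: subring0. Qed.

Lemma subringD x y : S x -> S y -> S (x + y).
Proof. by move=> Sx Sy; rewrite -[y]opprK; apply/subringB/subringN. Qed.

Lemma subringX x n : S x -> S (x ^+ n).
Proof.
move=> Sx; elim: n => [|n IH]; first exact: subring1.
by rewrite exprS; apply: subringM.
Qed.

Lemma subring_sum I (r : seq I) (P : pred I) (F : I -> B) :
  (forall i, P i -> S (F i)) -> S (\sum_(i <- r | P i) F i).
Proof.
by move=> SF; elim/big_ind: _ => //; [apply: subring0|apply: subringD].
Qed.

End Subring.

Section Submodules.
Variables (B : comPzRingType) (M : lmodType B).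
Implicit Types (S : B -> Prop) (N K L : M -> Prop) (l : seq M).

Definition is_submod S N : Prop :=
  [/\ N 0, forall u v, N u -> N v -> N (u + v)
    & forall c v, S c -> N v -> N (c *: v)].

Section Theory.
Variables (S : B -> Prop) (N : M -> Prop).
Hypotheses (S_ring : is_subring S) (N_mod : is_submod S N).

Lemma submod0 : N 0. Proof. by case: N_mod. Qed.

Lemma submodD u v : N u -> N v -> N (u + v).
Proof. by case: N_mod => _ + _; apply. Qed.

Lemma submodZ c v : S c -> N v -> N (c *: v).
Proof. by case: N_mod => _ _; apply. Qed.

Lemma submodN v : N v -> N (- v).
Proof.
move=> Nv; rewrite -scaleN1r; apply: submodZ => //.
exact/(subringN S_ring)/(subring1 S_ring).
Qed.

Lemma submodB u v : N u -> N v -> N (u - v).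
Proof. by move=> Nu Nv; apply/submodD/submodN. Qed.

Lemma submod_sum I (r : seq I) (P : pred I) (F : I -> M) :
  (forall i, P i -> N (F i)) -> N (\sum_(i <- r | P i) F i).
Proof.
by move=> NF; elim/big_ind: _ => //; [apply: submod0|apply: submodD].
Qed.

End Theory.

Lemma submodI S N K : is_submod S N -> is_submod S K ->
  is_submod S (fun v => N v /\ K v).
Proof.
move=> [N0 ND NZ] [K0 KD KZ]; split=> // [u v [? ?] [? ?]|c v Sc [? ?]].
  by split; [apply: ND|apply: KD].
by split; [apply: NZ|apply: KZ].
Qed.

Lemma submod_zero S : is_submod S (fun v => v = 0).
Proof.
by split=> // [u v -> ->|c v _ ->]; rewrite ?addr0 ?scaler0.
Qed.

(* The sum of K and the S-span of l. *)
Inductive spanmod S K l : M -> Prop :=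
| spanmod_base v : K v -> spanmod S K l v
| spanmod_step c x v :
    S c -> x \in l -> spanmod S K l v -> spanmod S K l (c *: x + v).

Lemma spanmod_submod S K l :
  is_subring S -> is_submod S K -> is_submod S (spanmod S K l).
Proof.
move=> Sr Km; split.
- exact/spanmod_base/(submod0 Km).
- move=> u v; elim=> {u} [u Ku|c x u Sc xl _ IH Sv].
    elim=> {v} [v Kv|c x v Sc xl _ IH]; first exact/spanmod_base/(submodD Km).
    by rewrite addrCA; apply: spanmod_step.
  by rewrite -addrA; apply: spanmod_step => //; apply: IH.
- move=> c v Sc; elim=> {v} [v Kv|d x v Sd xl _ IH].
    exact/spanmod_base/(submodZ Km).
  by rewrite scalerDr scalerA; apply: spanmod_step => //; apply: (subringM Sr).
Qed.

Lemma spanmod_min S N K l : is_submod S N -> (forall v, K v -> N v) ->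
  (forall x, x \in l -> N x) -> forall v, spanmod S K l v -> N v.
Proof.
move=> Nm KN lN v; elim=> {v} [v /KN//|c x v Sc /lN Nx _ Nv].
by apply: (submodD Nm) => //; apply: (submodZ Nm).
Qed.

Lemma spanmod_mem S K l x :
  is_subring S -> is_submod S K -> x \in l -> spanmod S K l x.
Proof.
move=> Sr Km xl; rewrite -[x]scale1r -[X in spanmod _ _ _ X]addr0.
by apply: spanmod_step xl _; [apply: subring1|apply/spanmod_base/(submod0 Km)].
Qed.

Lemma spanmod_sub S S' K K' l l' : (forall c, S c -> S' c) ->
  (forall v, K v -> K' v) -> {subset l <= l'} ->
  forall v, spanmod S K l v -> spanmod S' K' l' v.
Proof.
move=> SS KK ll v; elim=> {v} [v /KK|c x v /SS Sc /ll xl _]; first exact: spanmod_base.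
exact: spanmod_step.
Qed.

(* The quotient (N + K) / K is a noetherian S-module. *)
Variant noeth S N K : Prop := Noeth of
  forall N', is_submod S N' -> (forall v, N' v -> N v) ->
  exists2 l, forall x, x \in l -> N' x &
    forall v, N' v -> spanmod S (fun u => N' u /\ K u) l v.

Lemma noeth_sub S N N' K :
  noeth S N K -> (forall v, N' v -> N v) -> noeth S N' K.
Proof. by case=> Nn NN; split=> P Pm PN; apply: Nn => // v /PN/NN. Qed.

Lemma noeth_self S K : noeth S K K.
Proof.
by split=> N Nm NK; exists [::] => // v Nv; apply: spanmod_base; split=> //;
  apply: NK.
Qed.

(** Extensions of noetherian modules are noetherian: a submodule P is generated by lifts of
    generators of its image modulo K, together with generators of the intersection of P and K modulo
    L. *)
Lemma noeth_trans S N K L : is_subring S -> is_submod S K -> is_submod S L ->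
  noeth S N K -> noeth S K L -> noeth S N L.
Proof.
move=> Sr Km Lm [nNK] [nKL]; split=> P Pm PN.
have [l1 Pl1 s1] := nNK P Pm PN.
have [//||l2 Pl2 s2] := nKL (fun v => P v /\ K v); first exact: submodI.
  by move=> v [].
have Pl : is_submod S (fun u => P u /\ L u) by apply: submodI.
exists (l1 ++ l2) => [x|v /s1].
  by rewrite mem_cat => /orP[/Pl1//|/Pl2[]].
apply: spanmod_min; first exact: spanmod_submod.
  move=> u /s2; apply: spanmod_sub => // [w [[? ?] ?]|x]; first by split.
  by rewrite mem_cat => ->; rewrite orbT.
by move=> x xl; apply: spanmod_mem => //; rewrite mem_cat xl.
Qed.

End Submodules.

Definition noeth_subring (B : comPzRingType) (S : B -> Prop) : Prop :=
  noeth (M := B^o) S S (fun x => x = 0).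

(** The quotient is cyclic, so its submodules correspond to ideals of S: P gives the ideal [I] of
    those c for which c m is congruent modulo K to an element of P. Elements of P lifting generators
    of [I] then generate P modulo K. *)
Lemma noeth_cyclic (B : comPzRingType) (M : lmodType B) S (K : M -> Prop) m :
  is_subring S -> is_submod S K -> noeth_subring S ->
  noeth S (spanmod S K [:: m]) K.
Proof.
move=> Sr Km [nS]; split=> P Pm PN.
have spanE v : spanmod S K [:: m] v -> exists2 c, S c & K (v - c *: m).
  elim=> {v} [v Kv|c x v Sc + _ [d Sd Kd]].
    by exists 0; rewrite ?scale0r ?subr0 //; apply: (subring0 Sr).
  rewrite inE => /eqP->; exists (c + d); first exact: (subringD Sr).
  by rewrite scalerDl opprD addrACA subrr add0r.
pose I (c : B^o) := S c /\ exists2 v, P v & K (v - (c : B) *: m).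
have Im : is_submod S I.
  split=> [|c d [Sc [v Pv Kv]] [Sd [w Pw Kw]]|c d Sc [Sd [v Pv Kv]]].
  - split; first exact: (subring0 Sr).
    exists 0; first exact: (submod0 Pm).
    by rewrite scale0r subr0; apply: (submod0 Km).
  - split; first exact: (subringD Sr).
    exists (v + w); first exact: (submodD Pm).
    by rewrite scalerDl opprD addrACA; apply: (submodD Km).
  - split; first exact: (subringM Sr).
    exists (c *: v); first exact: (submodZ Pm).
    by rewrite -[c *: d]/(c * d) -scalerA -scalerBr; apply: (submodZ Km).
have [|l lI sI] := nS I Im; first by move=> c [].
have [|t [lt tl]] := @seq_exists _ _ (fun (c : B) v => P v /\ K (v - c *: m)) l.
  by move=> c /lI[_ [v Pv Kv]]; exists v.
have PK : is_submod S (fun u => P u /\ K u) by apply: submodI.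
exists t => [x /tl[c _ []//]|v Pv].
have [c Sc Kv] := spanE v (PN v Pv).
have /sI Ic : I c by split=> //; exists v.
(* The combination [w] of the lifts uses the coefficients that express c by generators of [I]. Then
   v and w are both congruent to c m, so v - w lies in P and in K. *)
suff [w Kw tw] : exists2 w, K (w - c *: m) &
    spanmod S (fun u => P u /\ K u) t w.
  rewrite -(subrK w v); apply: (submodD (spanmod_submod _ Sr PK)) (tw).
  apply: spanmod_base; split.
    apply: (submodB Sr Pm) Pv _; apply: spanmod_min tw => // [? []|x /tl[? _ []]] //.
  have -> : v - w = (v - c *: m) - (w - c *: m) by rewrite opprB addrA subrK.
  by apply: (submodB Sr Km).
elim: Ic => {v Pv c Sc Kv} [c [_ ->]|c x y Sc /lt[w wt [Pw Kw]] _ [u Ku tu]].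
  exists 0; last exact/spanmod_base/(submod0 PK).
  by rewrite scale0r subr0; apply: (submod0 Km).
exists (c *: w + u); last exact: spanmod_step.
rewrite -[c *: x]/(c * x) scalerDl opprD addrACA -scalerA -scalerBr.
by apply: (submodD Km) => //; apply: (submodZ Km).
Qed.

Lemma noeth_span (B : comPzRingType) (M : lmodType B) S (K : M -> Prop) l :
  is_subring S -> is_submod S K -> noeth_subring S ->
  noeth S (spanmod S K l) K.
Proof.
move=> Sr Km nS; elim: l => [|x l IH].
  apply: (noeth_sub (noeth_self S K)) => v.
  by case.
apply: noeth_trans IH => //; first exact: spanmod_submod.
apply: (noeth_sub (noeth_cyclic x Sr (spanmod_submod l Sr Km) nS)).
have Sm : is_submod S (spanmod S (spanmod S K l) [:: x]).
  by apply: spanmod_submod => //; apply: spanmod_submod.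
apply: spanmod_min => // [v Kv|y]; first exact/spanmod_base/spanmod_base.
rewrite in_cons => /predU1P[->|yl].
  by apply: spanmod_mem; rewrite ?mem_head //; apply: spanmod_submod.
exact/spanmod_base/spanmod_mem.
Qed.

(* Hilbert's basis theorem for the ring generated by a noetherian subring S and
   one element x; poly_lt n consists of the values at x of the polynomials over
   S of degree less than n. *)
Section HilbertBasis.
Variables (B : comPzRingType) (S : B -> Prop) (x : B).
Hypothesis S_ring : is_subring S.

Fixpoint poly_lt n (b : B) : Prop :=
  if n is n'.+1 then exists2 c, S c & poly_lt n' (b - c * x ^+ n') else b = 0.

Definition adjoin (b : B) : Prop := exists n, poly_lt n b.

Lemma poly_lt_submod n : is_submod (M := B^o) S (poly_lt n).
Proof.
elim: n => [|n [P0 PD PZ]]; first exact: submod_zero.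
split=> [|u v [c Sc Pu] [d Sd Pv]|c v Sc [d Sd Pv]].
- by exists 0; rewrite ?mul0r ?subr0 //; apply: (subring0 S_ring).
- exists (c + d); first exact: (subringD S_ring).
  by rewrite mulrDl opprD addrACA; apply: PD.
- exists (c * d); first exact: (subringM S_ring).
  by rewrite -mulrA -[c *: v]/(c * v) -mulrBr; apply: PZ.
Qed.

Lemma poly_lt_leq m n b : (m <= n)%N -> poly_lt m b -> poly_lt n b.
Proof.
move=> /subnK<-; elim: (n - m)%N => // k IH /IH Pb.
by exists 0; rewrite ?mul0r ?subr0 //; apply: (subring0 S_ring).
Qed.

Lemma poly_ltX n b : poly_lt n b -> poly_lt n.+1 (x * b).
Proof.
elim: n b => [b ->|n IH b [c Sc /IH Pb]].
  by rewrite mulr0; apply: (submod0 (poly_lt_submod 1)).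
by exists c; rewrite // exprS mulrCA -mulrBr.
Qed.

Lemma poly_ltXn k n b : poly_lt n b -> poly_lt (n + k) (x ^+ k * b).
Proof.
move=> Pb; elim: k => [|k IH]; first by rewrite addn0 mul1r.
by rewrite addnS exprS -mulrA; apply: poly_ltX.
Qed.

Lemma poly_lt_const c : S c -> poly_lt 1 c.
Proof. by move=> Sc; exists c; rewrite // mulr1 subrr. Qed.

Lemma poly_ltM m n b d : poly_lt m b -> poly_lt n d -> poly_lt (n + m) (b * d).
Proof.
elim: m b => [b -> _|m IH b [c Sc Pb] Pd].
  by rewrite mul0r; apply: (submod0 (poly_lt_submod _)).
rewrite -(subrK (c * x ^+ m) b) mulrDl.
apply: (submodD (poly_lt_submod _)).
  by apply: poly_lt_leq (IH _ Pb Pd); rewrite leq_add2l.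
apply: (@poly_lt_leq (n + m)); first by rewrite leq_add2l.
rewrite -mulrA; apply: (submodZ (poly_lt_submod (n + m))) => //.
exact: poly_ltXn.
Qed.

Lemma adjoin_subring : is_subring adjoin.
Proof.
split=> [|b d [m Pb] [n Pd]|b d [m Pb] [n Pd]].
- by exists 1%N; apply/poly_lt_const/(subring1 S_ring).
- exists (maxn m n); apply: (submodB S_ring (poly_lt_submod _)).
    exact: poly_lt_leq (leq_maxl _ _) Pb.
  exact: poly_lt_leq (leq_maxr _ _) Pd.
- by exists (n + m)%N; apply: poly_ltM.
Qed.

Lemma sub_adjoin c : S c -> adjoin c.
Proof. by move=> Sc; exists 1%N; apply: poly_lt_const. Qed.

Lemma mem_adjoin : adjoin x.
Proof.
by exists 2%N; rewrite -[x]mulr1; apply/poly_ltX/poly_lt_const/(subring1 S_ring).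
Qed.

Lemma adjoin_min (S' : B -> Prop) : is_subring S' ->
  (forall c, S c -> S' c) -> S' x -> forall b, adjoin b -> S' b.
Proof.
move=> S'r SS S'x b [n]; elim: n b => [b ->|n IH b [c Sc /IH S'b]].
  exact: (subring0 S'r).
rewrite -(subrK (c * x ^+ n) b); apply: (subringD S'r) => //.
by apply: (subringM S'r); [apply: SS|apply: (subringX S'r)].
Qed.

(** The leading coefficients of elements of an ideal I form an ideal of S. Finitely many elements of
    I, all brought to degree N, realise generators of it and serve to lower any degree that is at
    least N. What remains lies in [poly_lt N], which is noetherian over S. *)
Theorem hilbert_basis : noeth_subring S -> noeth_subring adjoin.
Proof.
move=> nS.
have nP n : noeth (M := B^o) S (poly_lt n) (fun b => b = 0).
  elim: n => [|n IH]; first exact: noeth_self.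
  apply: noeth_trans IH => //; [exact: poly_lt_submod|exact: submod_zero|].
  have nc := noeth_cyclic (x ^+ n : B^o) S_ring (poly_lt_submod n) nS.
  apply: (noeth_sub nc) => b [c Sc Pb].
  rewrite -(subrK (c * x ^+ n) b) addrC.
  by apply: spanmod_step; rewrite ?mem_head //; apply: spanmod_base.
split=> I Im Iadj.
have IX k b : I b -> I (x ^+ k * b).
  by apply: (submodZ Im); apply: (subringX adjoin_subring); apply: mem_adjoin.
have ISm : is_submod (M := B^o) S I.
  by case: Im => I0 ID IZ; split=> // c v /sub_adjoin; apply: IZ.
(* Since x may satisfy relations over S, an element has no well-defined degree or leading
   coefficient; [lead] is therefore a relation between a degree and a possible coefficient. *)
pose lead n (a : B^o) := S a /\ exists2 b, I b & poly_lt n (b - a * x ^+ n).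
have lead_leq m n a : (m <= n)%N -> lead m a -> lead n a.
  move=> le_mn [Sa [b Ib Pb]]; split=> //.
  exists (x ^+ (n - m) * b); first exact: IX.
  move/(poly_ltXn (n - m)): Pb; rewrite subnKC // mulrBr mulrCA -exprD.
  by rewrite subnK.
have lead_submod : is_submod (M := B^o) S (fun a => exists n, lead n a).
  split=> [|a a' [m La] [n La']|c a Sc [n [Sa [b Ib Pb]]]].
  - exists 0%N; split; first exact: (subring0 S_ring).
    by exists 0; [apply: (submod0 Im)|rewrite /= mul0r subr0].
  - have [Sa [b Ib Pb]] := lead_leq _ _ _ (leq_maxl m n) La.
    have [Sa' [b' Ib' Pb']] := lead_leq _ _ _ (leq_maxr m n) La'.
    exists (maxn m n); split; first exact: (subringD S_ring).
    exists (b + b'); first exact: (submodD Im).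
    by rewrite mulrDl opprD addrACA; apply: (submodD (poly_lt_submod _)).
  - exists n; split; first exact: (subringM S_ring).
    exists (c * b); first exact: (submodZ ISm).
    rewrite -[c *: a]/(c * a) -mulrA -mulrBr.
    exact: (submodZ (poly_lt_submod _)).
have [nS'] := nS; have [|l lL sL] := nS' _ lead_submod; first by move=> a [n []].
(* Multiplication by powers of x raises the degree and keeps the leading coefficient, so one degree
   N serves all generators. *)
have [N LN] := seq_bound lead_leq lL.
have [|g [lg gl]] := @seq_exists _ _
    (fun a b : B => I b /\ poly_lt N (b - a * x ^+ N)) l.
  by move=> a /LN[_ [b Ib Pb]]; exists b.
have [nPN] := nP N; have [||h hI sh] := nPN (fun b => I b /\ poly_lt N b); last first.
- pose G := g ++ h.
  have Sm : is_submod (M := B^o) adjoin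
      (spanmod adjoin (fun b => I b /\ b = 0) (G : seq B^o)).
    apply: spanmod_submod; first exact: adjoin_subring.
    by apply: submodI => //; apply: submod_zero.
  have SIm : is_submod (M := B^o) S (fun b => I b /\ b = 0).
    by apply: submodI => //; apply: submod_zero.
  exists G => [b|b Ib].
    by rewrite mem_cat => /orP[/gl[? _ []]|/hI[]].
  have [n Pn] := Iadj _ Ib.
  elim: n b Ib Pn => [b Ib Pb|n IH b Ib Pn]; first exact: spanmod_base.
  have [le_nN|lt_Nn] := leqP n.+1 N.
    have Pb := poly_lt_leq le_nN Pn.
    apply: spanmod_sub (sh _ (conj Ib Pb)) => //; first exact: sub_adjoin.
      by move=> v [[? _] ?]; split.
    by move=> y yh; rewrite mem_cat yh orbT.
  have [c Sc Pb] := Pn.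
  have Lc : exists n, lead n c by exists n; split=> //; exists b.
  (* Such a [d] has the same leading coefficient c as b, in degree N; subtracting x^(n-N) d from b
     cancels the term c x^n and allows the induction on n. *)
  suff [d [Id Pd Gd]] : exists d, [/\ I d, poly_lt N (d - c * x ^+ N) &
      spanmod adjoin (fun b => I b /\ b = 0) (G : seq B^o) d].
    rewrite -(subrK (x ^+ (n - N) * d) b); apply: (submodD Sm).
      apply: IH.
        by apply: (submodB adjoin_subring Im) => //; apply: IX.
      rewrite -(subrK (c * x ^+ n) b) -addrA.
      apply: (submodD (poly_lt_submod n)) => //.
      move/(poly_ltXn (n - N)): Pd; rewrite subnKC //.
      move/(submodN S_ring (poly_lt_submod n)).
      by rewrite mulrBr mulrCA -exprD subnK // opprB.
    apply: (submodZ Sm) => //.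
    exact/(subringX adjoin_subring)/mem_adjoin.
  elim: (sL _ Lc) => [a [_ ->]|a y d Sa /lg[e eg [Ie Pe]] _ [f [If Pf Gf]]].
    exists 0; rewrite mul0r subr0; split=> //; first exact: (submod0 Im).
      exact: (submod0 (poly_lt_submod _)).
    exact: (submod0 Sm).
  exists (a * e + f); split.
  - by apply: (submodD Im) => //; apply: (submodZ ISm).
  - rewrite -[a *: y]/(a * y) mulrDl opprD addrACA -mulrA -mulrBr.
    apply: (submodD (poly_lt_submod N)) => //.
    exact: (submodZ (poly_lt_submod N)).
  - apply: spanmod_step => //; first exact: sub_adjoin.
    by rewrite mem_cat eg.
- by move=> b [].
- by apply: submodI => //; apply: poly_lt_submod.
Qed.

End HilbertBasis.

(** * Finitely generated algebras over a noetherian ring *)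

Section GenSubalg.
Variables (R B : comPzRingType) (f : {rmorphism R -> B}).

Lemma gen_subring s : is_subring (gen_subalg f s).
Proof.
split; first by rewrite -(rmorph1 f); apply: gen_scalar.
  exact: gen_sub.
exact: gen_mul.
Qed.

Lemma gen_min s (S : B -> Prop) : is_subring S -> (forall r, S (f r)) ->
  (forall x, x \in s -> S x) -> forall b, gen_subalg f s b -> S b.
Proof.
move=> Sr Sf sS b; elim=> {b} // x y _ Sx _ Sy.
- exact: (subringB Sr).
- exact: (subringM Sr).
Qed.

Lemma gen_sub_seq s t : {subset s <= t} ->
  forall b, gen_subalg f s b -> gen_subalg f t b.
Proof.
move=> st; apply: gen_min; first exact: gen_subring.
  exact: gen_scalar.
by move=> x /st; apply: gen_mem.
Qed.

(** With no generators the algebra is the image of R, and its ideals are images of ideals of R. Each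
    further generator is an application of Hilbert's basis theorem. *)
Lemma gen_noeth s : noetherian R -> noeth_subring (gen_subalg f s).
Proof.
move=> nR; elim: s => [|x s IH].
  split=> I Im Igen.
  have genE b : gen_subalg f [::] b -> exists r, b = f r.
    elim=> {b} [r|//|? ? _ [x ->] _ [y ->]|? ? _ [x ->] _ [y ->]].
    - by exists r.
    - by exists (x - y); rewrite rmorphB.
    - by exists (x * y); rewrite rmorphM.
  have [|l lE] := nR (fun r => I (f r)).
    split=> [|u v Iu Iv|u v Iv].
    - by rewrite rmorph0; apply: (submod0 Im).
    - by rewrite rmorphD; apply: (submodD Im).
    - by rewrite rmorphM; apply: (submodZ Im) => //; apply: gen_scalar.
  have lI r : r \in l -> I (f r).
    (* These coefficients are 1 at the first occurrence of r in l and 0 elsewhere, so the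
       combination is r itself. *)
    move=> rl; apply/lE; exists (fun i => (i == index r l)%:R).
    rewrite (bigD1 (Ordinal (etrans (index_mem r l) rl))) //= eqxx mul1r.
    rewrite nth_index // big1 ?addr0 // => i.
    by rewrite -val_eqE /= => /negPf->; rewrite mul0r.
  exists [seq f r | r <- l] => [b /mapP[r /lI Ir ->]//|b Ib].
  have [r br] := genE _ (Igen _ Ib).
  have /lE[c rE] : I (f r) by rewrite -br.
  have Sm : is_submod (M := B^o) (gen_subalg f [::])
      (spanmod (gen_subalg f [::]) (fun b => I b /\ b = 0)
         ([seq f r | r <- l] : seq B^o)).
    apply: spanmod_submod; first exact: gen_subring.
    by apply: submodI => //; apply: submod_zero.
  rewrite br rE rmorph_sum; apply: (submod_sum Sm) => i _.
  rewrite rmorphM; apply: (submodZ Sm); first exact: gen_scalar.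
  apply: spanmod_mem; first exact: gen_subring.
    by apply: submodI => //; apply: submod_zero.
  by apply: map_f; apply: mem_nth.
have -> : gen_subalg f (x :: s) = adjoin (gen_subalg f s) x.
  apply/funext=> b; apply/propext; split.
    apply: gen_min; first by apply: adjoin_subring; apply: gen_subring.
      by move=> r; apply: sub_adjoin; apply: gen_scalar.
    move=> y; rewrite in_cons => /predU1P[->|ys].
      by apply: mem_adjoin; apply: gen_subring.
    by apply: sub_adjoin; apply: gen_mem.
  apply: adjoin_min; first exact: gen_subring.
    by apply: gen_sub_seq => y ys; rewrite in_cons ys orbT.
  exact/gen_mem/mem_head.
by apply: hilbert_basis IH; apply: gen_subring.
Qed.

End GenSubalg.

(** * Integral extensions *)

Lemma ideal_submod (B : comPzRingType) (S I : B -> Prop) :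
  is_ideal I -> is_submod (M := B^o) S I.
Proof. by case=> I0 ID IM; split=> // c v _; apply: IM. Qed.

Section Ideal.
Variables (B : comPzRingType) (I : B -> Prop).
Hypothesis I_ideal : is_ideal I.

Lemma ideal0 : I 0. Proof. by case: I_ideal. Qed.

Lemma idealD x y : I x -> I y -> I (x + y).
Proof. by case: I_ideal => _ + _; apply. Qed.

Lemma ideal_mull r x : I x -> I (r * x).
Proof. by case: I_ideal => _ _; apply. Qed.

Lemma ideal_mulr r x : I x -> I (x * r).
Proof. by rewrite mulrC; apply: ideal_mull. Qed.

Lemma idealN x : I x -> I (- x).
Proof. by move=> Ix; rewrite -mulN1r; apply: ideal_mull. Qed.

Lemma idealB x y : I x -> I y -> I (x - y).
Proof. by move=> Ix Iy; apply/idealD/idealN. Qed.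

Lemma ideal_trans y x z : I (x - y) -> I (y - z) -> I (x - z).
Proof. by move=> Ixy Iyz; rewrite -(subrK y x) -addrA; apply: idealD. Qed.

Lemma ideal_cong x y : I (x - y) -> I y -> I x.
Proof. by move=> Ixy Iy; rewrite -(subrK y x); apply: idealD. Qed.

Lemma ideal_sum J (r : seq J) (P : pred J) (F : J -> B) :
  (forall i, P i -> I (F i)) -> I (\sum_(i <- r | P i) F i).
Proof. by move=> IF; elim/big_ind: _ => //; [apply: ideal0|apply: idealD]. Qed.

End Ideal.

(** If P failed somewhere, dependent choice would give a strictly increasing chain of ideals at
    which P fails. The union of the chain is finitely generated, hence is already reached at a
    finite stage, a contradiction. *)
Lemma ideal_ind (B : comPzRingType) (P : (B -> Prop) -> Prop) :
  noeth_subring (fun _ : B => True) ->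
  (forall I, is_ideal I ->
    (forall J, is_ideal J -> (forall x, I x -> J x) -> (exists2 x, J x & ~ I x) ->
      P J) -> P I) ->
  forall I, is_ideal I -> P I.
Proof.
move=> [nB] step I0 I0_ideal; apply: contrapT => nP0.
pose bad := {I : B -> Prop | is_ideal I /\ ~ P I}.
have next (I : bad) : exists J : bad,
    (forall x, sval I x -> sval J x) /\ exists2 x, sval J x & ~ sval I x.
  case: I => I [I_ideal nPI] /=; apply: contrapT => nJ.
  apply: nPI; apply: step => // J J_ideal IJ neIJ; apply: contrapT => nPJ.
  by apply: nJ; exists (exist _ J (conj J_ideal nPJ)).
have [F FP] := choice next.
pose chain i := sval (iter i F (exist _ I0 (conj I0_ideal nP0))).
have chain_ideal i : is_ideal (chain i) by rewrite /chain; case: (iter _ _ _) => ? [].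
have chain_leq i j x : (i <= j)%N -> chain i x -> chain j x.
  move=> /subnK<- xi; elim: (j - i)%N => // k.
  rewrite addSn /chain iterS.
  by have [+ _] := FP (iter (k + i) F (exist _ I0 (conj I0_ideal nP0))); apply.
have [||l lU sl] := nB (fun x => exists i, chain i x); last first.
- have [i li] := seq_bound chain_leq lU.
  have [_ [x Fx nx]] := FP (iter i F (exist _ I0 (conj I0_ideal nP0))).
  apply: nx; have /sl : exists j, chain j x by exists i.+1.
  rewrite -/(chain i).
  apply: spanmod_min; [exact/ideal_submod/chain_ideal| |exact: li].
  by move=> _ [_ ->]; apply: (ideal0 (chain_ideal i)).
- by [].
- split=> [|x y [i xi] [j yj]|c x _ [i xi]].
  + by exists 0%N; apply: (ideal0 (chain_ideal _)).
  + exists (maxn i j); apply: (idealD (chain_ideal _)).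
      exact: chain_leq (leq_maxl _ _) xi.
    exact: chain_leq (leq_maxr _ _) yj.
  + by exists i; apply: (ideal_mull (chain_ideal _)).
Qed.

Lemma finite_type_noeth (R B : comPzRingType) (f : {rmorphism R -> B}) :
  noetherian R -> finite_type f -> noeth_subring (fun _ : B => True).
Proof.
move=> nR [s sB]; have -> : (fun=> True) = gen_subalg f s.
  by apply/funext => b; apply/propext; split.
exact: gen_noeth.
Qed.

Section Integral.
Variable B : comPzRingType.
Local Notation ispan := (@spanmod B B^o).
Implicit Types (S J : B -> Prop) (q : seq (B * nat)).

(** A pair (x, n) records a variable and a strict bound on its exponent; these products span an
    algebra in which each x^n is congruent to a scalar. *)
Fixpoint monomials q : seq B :=
  if q is (x, n) :: q' then [seq x ^+ j * m | j <- iota 0 n, m <- monomials q']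
  else [:: 1].

Lemma mem_monomials x n q j m : (j < n)%N -> m \in monomials q ->
  x ^+ j * m \in monomials ((x, n) :: q).
Proof.
move=> jn mq; apply/allpairsP; exists (j, m).
by rewrite mem_iota.
Qed.

(** Multiplying a monomial by one of its variables x either keeps the exponent below n or produces
    x^n, which is replaced modulo J by an element g of S. The other variables are handled by
    induction on q. *)
Lemma spanmod_monomialsM S J q : is_subring S -> is_ideal J ->
  (forall p, p \in q -> exists2 g, S g & J (g - p.1 ^+ p.2)) ->
  (forall p, p \in q -> (0 < p.2)%N) ->
  forall p w, p \in q -> ispan S J (monomials q) w ->
    ispan S J (monomials q) (p.1 * w).
Proof.
move=> Sr J_ideal; have Jm := ideal_submod S J_ideal.
elim: q => [//|[x n] q IH] qg q_gt0 p w pq.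
have Wm := spanmod_submod (monomials ((x, n) :: q) : seq B^o) Sr Jm.
elim=> {w} [w Jw|c m w Sc mq _ Wpw].
  by apply: spanmod_base; apply: ideal_mull.
rewrite mulrDr; apply: (submodD Wm) => //.
rewrite -[c *: m]/(c * m) mulrCA; apply: (submodZ Wm) => //.
have [j [m' [jn mq' ->]]] :
    exists j m', [/\ (j < n)%N, m' \in monomials q & m = x ^+ j * m'].
  have /allpairsP[[j m'] /= [+ mq' ->]] := mq.
  by rewrite mem_iota => /andP[_ jn]; exists j, m'.
move: pq; rewrite in_cons => /predU1P[->/=|pq].
  rewrite mulrA -exprS; have [jn'|nj] := ltnP j.+1 n.
    by apply: spanmod_mem => //; apply: mem_monomials.
  have -> : j.+1 = n by apply/eqP; rewrite eqn_leq jn.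
  have [g Sg Jg] := qg _ (mem_head _ _).
  rewrite -(subrK (g * m') (x ^+ n * m')) -mulrBl; apply: (submodD Wm).
    apply: spanmod_base; apply: (ideal_mulr J_ideal).
    by rewrite -[_ - _]opprB; apply: (idealN J_ideal).
  apply: (submodZ Wm) => //; apply: spanmod_mem => //.
  (* The cofactor [m'] is listed as x^0 m', which requires n > 0; this follows from j < n. *)
  by rewrite -[m']mul1r -(expr0 x); apply: mem_monomials => //; case: (n) jn.
rewrite mulrCA.
have : ispan S J (monomials q) (p.1 * m').
  apply: IH => // [p' p'q|p' p'q|]; last exact: spanmod_mem.
    by apply: qg; rewrite in_cons p'q orbT.
  by apply: q_gt0; rewrite in_cons p'q orbT.
elim=> {m mq m' mq'} [m Jm'|d m v Sd mq _ Wv].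
  by apply: spanmod_base; apply: (ideal_mull J_ideal).
rewrite mulrDr; apply: (submodD Wm) => //.
rewrite -[d *: m]/(d * m) mulrCA; apply: (submodZ Wm) => //.
by apply: spanmod_mem => //; apply: mem_monomials.
Qed.

(** The powers g of the generators serve as scalars [gs]. Modulo J each generator x is a root of the
    monic equation X^n = g, so the monomials with exponents below these n span T. *)
Lemma integral_finite (R : comPzRingType) (psi : {rmorphism R -> B})
    (J T G : B -> Prop) t : is_ideal J ->
  (forall b, T b -> exists2 b', gen_subalg psi t b' & J (b - b')) ->
  (forall x, x \in t -> exists n g, [/\ (0 < n)%N, G g & J (g - x ^+ n)]) ->
  exists gs ms, (forall g, g \in gs -> G g) /\
    forall b, T b -> ispan (gen_subalg psi gs) J ms b.
Proof.
move=> J_ideal tT tG.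
have [|u [tu ut]] := @seq_exists _ _ (fun x (p : (B * nat) * B) =>
    [/\ p.1.1 = x, (0 < p.1.2)%N, G p.2 & J (p.2 - x ^+ p.1.2)]) t.
  by move=> x /tG[n [g [? ? ?]]]; exists ((x, n), g).
pose gs := [seq p.2 | p <- u]; pose q := [seq p.1 | p <- u].
exists gs, (monomials q); split=> [_ /mapP[p /ut[x _ [_ _ Gp _]] ->]//|b Tb].
have Sr := gen_subring psi gs; have Jm := ideal_submod (gen_subalg psi gs) J_ideal.
have Wm := spanmod_submod (monomials q : seq B^o) Sr Jm.
have q_gt0 p : p \in q -> (0 < p.2)%N.
  by move=> /mapP[p' /ut[x _ [_ ? _ _]] ->].
have tW x w : x \in t -> ispan (gen_subalg psi gs) J (monomials q) w ->
    ispan (gen_subalg psi gs) J (monomials q) (x * w).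
  move=> /tu[p pu [<- _ _ _]]; apply: spanmod_monomialsM => //; last exact: map_f.
  move=> _ /mapP[p' p'u ->]; exists p'.2; first exact/gen_mem/map_f.
  by have [x' _ [-> _ _ ?]] := ut _ p'u.
have W1 : ispan (gen_subalg psi gs) J (monomials q) 1.
  apply: spanmod_mem => //.
  elim: (q) q_gt0 => [|[x n] q' IH] q_gt0 /=; first exact: mem_head.
  rewrite -[1]mulr1 -{1}(expr0 x); apply: mem_monomials.
    by apply: (q_gt0 (x, n)); apply: mem_head.
  by apply: IH => p pq'; apply: q_gt0; rewrite in_cons pq' orbT.
have [b' gb' Jb] := tT b Tb.
rewrite -(subrK b' b); apply: (submodD Wm); first exact: spanmod_base.
(* The span contains 1 and is stable under every generator in t. Replacing 1 by an arbitrary element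
   w of the span makes the induction on [b'] go through products. *)
rewrite -[b']mulr1; move: (1) W1.
elim: gb' => {b' Jb} [r|x xt|x y _ IHx _ IHy|x y _ IHx _ IHy] w Ww.
- by apply: (submodZ Wm) => //; apply: gen_scalar.
- exact: tW.
- by rewrite mulrBl; apply: (submodB Sr Wm); [apply: IHx|apply: IHy].
- by rewrite -mulrA; apply/IHx/IHy.
Qed.

(* The image of V in B / J is a finitely generated algebra. *)
Definition fg_mod (R : comPzRingType) (psi : {rmorphism R -> B})
    (V J : B -> Prop) : Prop :=
  exists2 s, forall x, x \in s -> V x &
    forall b, V b -> exists2 b', gen_subalg psi s b' & J (b - b').

(** * An Artin-Tate argument modulo an ideal *)

Section ArtinTate.
Variables (R : comPzRingType) (psi : {rmorphism R -> B}) (J T V G : B -> Prop).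
Hypotheses (nR : noetherian R) (J_ideal : is_ideal J) (V_ring : is_subring V).
Hypotheses (VT : forall b, V b -> T b) (GV : forall b, G b -> V b).
Hypotheses (psiG : forall r, G (psi r)) (T_fg : fg_mod psi T J).
Hypothesis T_integral :
  forall b, T b -> exists n g, [/\ (0 < n)%N, G g & J (g - b ^+ n)].

Lemma gen_sub_pred gs : (forall g, g \in gs -> G g) ->
  forall b, gen_subalg psi gs b -> V b.
Proof.
move=> gsG; apply: gen_min => // [r|g /gsG]; last exact: GV.
exact/GV/psiG.
Qed.

(* As in the Artin-Tate lemma, T / J is a finite module over a finitely
   generated subalgebra of G, and V is a submodule of T. *)
Lemma finite_mod_integral :
  exists gs l, [/\ forall g, g \in gs -> G g, forall x, x \in l -> V x &
    forall b, V b -> ispan (gen_subalg psi gs) (fun b => V b /\ J b) l b].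
Proof.
have [t tT sT] := T_fg.
have [|gs [ms [gsG sW]]] := integral_finite (G := G) J_ideal sT.
  by move=> x /tT/T_integral.
have [nW] := noeth_span ms (gen_subring psi gs)
  (ideal_submod (gen_subalg psi gs) J_ideal) (gen_noeth psi gs nR).
have [||l lV sl] := nW V.
- split=> [|x y|c x /(gen_sub_pred gsG)].
  + exact: (subring0 V_ring).
  + exact: (subringD V_ring).
  + exact: (subringM V_ring).
- by move=> v /VT/sW.
by exists gs, l.
Qed.

Lemma fg_mod_integral : fg_mod psi V J.
Proof.
have [gs [l [gsG lV sl]]] := finite_mod_integral.
exists (gs ++ l) => [x|b /sl].
  by rewrite mem_cat => /orP[/gsG/GV|/lV].
elim=> {b} [b [_ Jb]|c x b gc xl _ [b' gb' Jb]].
  by exists 0; rewrite ?subr0 //; apply: (subring0 (gen_subring _ _)).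
exists (c * x + b'); last by rewrite opprD addrACA subrr add0r.
apply: (subringD (gen_subring _ _)) => //; apply: gen_mul.
  by apply: gen_sub_seq gc => y; rewrite mem_cat => ->.
by apply: gen_mem; rewrite mem_cat xl orbT.
Qed.

End ArtinTate.

End Integral.

(** * Invariants of a graded algebra *)

(* In the application X is a bialgebra, T h b = h b - eps(h) b measures the
   failure of b to be invariant, and hc n b is the component of degree n of b. *)
Section GradedInvariants.
Variables (R B : comPzRingType) (psi : {rmorphism R -> B}).
Variables (X : Type) (T : X -> B -> B) (hc : nat -> B -> B) (s0 : seq B).

Definition inv_mod (I : B -> Prop) (b : B) : Prop := forall h, I (T h b).

Definition T_stable (I : B -> Prop) : Prop :=
  is_ideal I /\ forall h b, I b -> I (T h b).

Definition graded (I : B -> Prop) : Prop := forall n b, I b -> I (hc n b).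

Hypotheses (nR : noetherian R) (psi_ft : finite_type psi).
Hypothesis TB : forall h x y, T h (x - y) = T h x - T h y.
Hypothesis T_psi : forall h r, T h (psi r) = 0.
Hypothesis T_leibniz : forall I, T_stable I -> forall f b h,
  inv_mod I f -> I (T h (f * b) - f * T h b).
Hypothesis T_power : forall I, T_stable I -> forall f, inv_mod I f ->
  exists n g, [/\ (0 < n)%N, inv_mod (fun b => b = 0) g & I (g - f ^+ n)].
Hypothesis hcB : forall n x y, hc n (x - y) = hc n x - hc n y.
Hypothesis hc_hc : forall m n b, hc m (hc n b) = if m == n then hc n b else 0.
Hypothesis hcM : forall n x y,
  hc n (x * y) = \sum_(i < n.+1) hc i x * hc (n - i) y.
Hypothesis hc_sum : forall b, exists n, b = \sum_(i < n.+1) hc i b.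
Hypothesis hc_psi : forall n r, hc n (psi r) = if n == 0%N then psi r else 0.
Hypothesis hcT : forall n h b, hc n (T h b) = T h (hc n b).
Hypothesis s0_inv : forall x, x \in s0 -> inv_mod (fun b => b = 0) x.
Hypothesis s0_gen : forall b, gen_subalg psi s0 (hc 0 b).

Let inv_mod_psi I r : T_stable I -> inv_mod I (psi r).
Proof. by move=> [I_ideal _] h; rewrite T_psi; apply: ideal0. Qed.

Let inv_mod_sub (I J : B -> Prop) : (forall b, I b -> J b) ->
  forall b, inv_mod I b -> inv_mod J b.
Proof. by move=> IJ b Ib h; apply/IJ/Ib. Qed.

Let inv0_mod I b : T_stable I -> inv_mod (fun b => b = 0) b -> inv_mod I b.
Proof.
by move=> [I_ideal _]; apply: inv_mod_sub => _ ->; apply: ideal0.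
Qed.

Lemma inv_mod_subring I : T_stable I -> is_subring (inv_mod I).
Proof.
move=> Ist; have [I_ideal _] := Ist; split=> [|x y Ix Iy|x y Ix Iy] h.
- by rewrite -(rmorph1 psi) T_psi; apply: ideal0.
- by rewrite TB; apply: (idealB I_ideal).
- apply: (ideal_cong I_ideal) (T_leibniz Ist y h Ix) _.
  exact: (ideal_mull I_ideal).
Qed.

Let gen_inv I (s : seq B) : T_stable I -> (forall x, x \in s -> inv_mod I x) ->
  forall b, gen_subalg psi s b -> inv_mod I b.
Proof.
move=> Ist sI; apply: gen_min => //; first exact: inv_mod_subring.
by move=> r; apply: inv_mod_psi.
Qed.

Let hcM_homog n f : hc n f = f -> forall m b,
  hc m (f * b) = if (n <= m)%N then f * hc (m - n) b else 0.
Proof.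
move=> fn m b; rewrite hcM.
have fE i : hc i f = if i == n then f else 0 by rewrite -fn hc_hc; case: eqP.
case: leqP => [le_nm|lt_mn].
  rewrite (bigD1 (Ordinal (le_nm : n < m.+1)%N)) //= fE eqxx big1 ?addr0 // => i.
  by rewrite -val_eqE /= fE => /negPf->; rewrite mul0r.
apply: big1 => i _; rewrite fE; case: eqP => [in_|_]; last by rewrite mul0r.
by have := ltn_ord i; rewrite in_ ltnS leqNgt lt_mn.
Qed.

(** Since T commutes with taking components and I is graded, the components of an element invariant
    modulo I are again invariant modulo I. *)
Let homog_gens I (s : seq B) : T_stable I -> graded I ->
  (forall x, x \in s -> inv_mod I x) ->
  exists s' : seq B, [/\ forall x, x \in s' -> inv_mod I x,
    forall x, x \in s' -> exists n, hc n x = x &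
    forall x, x \in s -> gen_subalg psi s' x].
Proof.
move=> Ist Igr; elim: s => [|x s IH] sI; first by exists [::].
have [y ys|s' [s'I s'h s's]] := IH; first by apply: sI; rewrite in_cons ys orbT.
have [N xN] := hc_sum x.
pose cx := [seq hc i x | i <- iota 0 N.+1].
exists (cx ++ s'); split=> y.
- rewrite mem_cat => /orP[/mapP[i _ ->] h|/s'I//].
  by rewrite -hcT; apply: Igr; apply: sI; apply: mem_head.
- rewrite mem_cat => /orP[/mapP[i _ ->]|/s'h//].
  by exists i; rewrite hc_hc eqxx.
- rewrite in_cons => /predU1P[->|/s's]; last first.
    by apply: gen_sub_seq => z zs; rewrite mem_cat zs orbT.
  rewrite [x in gen_subalg _ _ x]xN; apply: (subring_sum (gen_subring _ _)) => i _.
  apply: gen_mem; rewrite mem_cat; apply/orP; left.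
  by apply: (map_f (hc^~ x)); rewrite mem_iota ltn_ord.
Qed.

Let gen_hc (s : seq B) : (forall x, x \in s -> exists n, hc n x = x) ->
  forall b, gen_subalg psi s b -> forall m, gen_subalg psi s (hc m b).
Proof.
move=> sh b; have gr := gen_subring psi s.
elim=> {b} [r|x xs|x y _ IHx _ IHy|x y _ IHx _ IHy] m.
- by rewrite hc_psi; case: eqP => _; [apply: gen_scalar|apply: (subring0 gr)].
- have [n nx] := sh x xs; rewrite -nx hc_hc nx.
  by case: eqP => _; [apply: gen_mem|apply: (subring0 gr)].
- by rewrite hcB; apply: gen_sub.
- by rewrite hcM; apply: (subring_sum gr) => i _; apply: gen_mul.
Qed.

Theorem graded_invariants_fg I :
  T_stable I -> graded I -> fg_mod psi (inv_mod I) I.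
Proof.
move=> /[dup] -[I0_ideal _].
have nB := finite_type_noeth nR psi_ft.
move: I I0_ideal; apply: (ideal_ind nB) => I I_ideal IH Ist Igr.
have [[n [f0 [n_gt0 f0I nIf]]]|triv] :=
    pselect (exists n f, [/\ (0 < n)%N, inv_mod I f & ~ I (hc n f)]); last first.
  (* Here all components of positive degree of an invariant lie in I, so b is congruent to its
     component of degree 0, which [s0] generates. *)
  exists s0 => [x /s0_inv|b bI]; first exact: inv0_mod.
  exists (hc 0 b) => //; have [N bN] := hc_sum b.
  rewrite [X in I (X - _)]bN big_ord_recl addrC addKr.
  apply: (ideal_sum I_ideal) => i _; apply: contrapT => nI.
  by apply: triv; exists (lift ord0 i), b.
pose f := hc n f0.
have fn : hc n f = f by rewrite hc_hc eqxx.
have fI : inv_mod I f by move=> h; rewrite -hcT; apply/Igr/f0I.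
pose I1 b := exists c, I (b - f * c).
pose I2 b := I (f * b).
have I1_ideal : is_ideal I1.
  split=> [|x y [c Ic] [d Id]|r x [c Ic]].
  - by exists 0; rewrite mulr0 subr0; apply: ideal0.
  - by exists (c + d); rewrite mulrDr opprD addrACA; apply: idealD.
  - by exists (r * c); rewrite mulrCA -mulrBr; apply: ideal_mull.
have I1st : T_stable I1.
  split=> // h b [c Ic]; exists (T h c).
  apply: (ideal_trans I_ideal (y := T h (f * c))); last exact: T_leibniz.
  by rewrite -TB; apply: Ist.2.
have I1gr : graded I1.
  move=> m b [c /(Igr m)]; rewrite hcB (hcM_homog fn); case: leqP => _ Ic.
    by exists (hc (m - n) c).
  by exists 0; rewrite mulr0.
have I2_ideal : is_ideal I2.
  split=> [|x y Ix Iy|r x Ix]; rewrite /I2.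
  - by rewrite mulr0; apply: ideal0.
  - by rewrite mulrDr; apply: idealD.
  - by rewrite mulrCA; apply: ideal_mull.
have I2st : T_stable I2.
  split=> // h b Ib; apply: (ideal_cong I_ideal (y := T h (f * b))).
    by rewrite -opprB; apply: (idealN I_ideal); apply: T_leibniz.
  exact: Ist.2.
have I2gr : graded I2.
  move=> m b /(Igr (n + m)%N); rewrite (hcM_homog fn) leq_addr.
  by rewrite addKn.
have sub1 b : I b -> I1 b by exists 0; rewrite mulr0 subr0.
have sub2 b : I b -> I2 b by apply: ideal_mull.
have inv0_ring := inv_mod_subring Ist.
have psi0 r : inv_mod (fun b => b = 0) (psi r) by move=> h; apply: T_psi.
(* The image of the invariants of B/I in B/I1 lies between the image of the invariants of B and the
   invariants of B/I1. The latter are finitely generated by induction, as f lies in I1 but not in I,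
   and integral over the former by [T_power]. *)
have [s1 s1I s1g] : fg_mod psi (inv_mod I) I1.
  apply: (fg_mod_integral (T := inv_mod I1) (G := inv_mod (fun b => b = 0))) => //.
  - exact: inv_mod_sub.
  - by move=> b; apply: inv0_mod.
  - apply: IH => //; exists f => //; exists 1.
    by rewrite mulr1 subrr; apply: ideal0.
  - exact: T_power.
(* Modulo I, f T(h, c) is congruent to T(h, fc) because f is invariant, and fc is congruent to the
   invariant b - b1. Hence f T(h, c) lies in I, which says that T(h, c) lies in I2. *)
have div_inv b b1 c : inv_mod I b -> inv_mod I b1 -> I (b - b1 - f * c) ->
    inv_mod I2 c.
  move=> bI b1I Ic h; rewrite /I2.
  apply: (ideal_cong I_ideal (y := T h (f * c))).
    by rewrite -opprB; apply: (idealN I_ideal); apply: T_leibniz.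
  have -> : f * c = b - b1 - (b - b1 - f * c) by rewrite opprB addrC subrK.
  rewrite 2!TB; apply: (idealB I_ideal); last exact: Ist.2.
  exact: (idealB I_ideal).
(* If I2 <> I, then fc is recovered from the image of c in B / I2. *)
have [[x I2x nIx]|I2I] := pselect (exists2 x, I2 x & ~ I x).
  have [gs [l [gsG lI2 sl]]] := finite_mod_integral (psi := psi)
    (G := inv_mod (fun b => b = 0)) nR I2_ideal (inv_mod_subring I2st)
    (fun b Ib => Ib) (fun b => @inv0_mod _ b I2st) psi0
    (IH I2 I2_ideal sub2 (ex_intro2 _ _ x I2x nIx) I2st I2gr) (T_power I2st).
  (* The scalars [gs] are invariant in B itself, hence also modulo I. The products f y are invariant
     modulo I because y is invariant modulo I2 = (I : f). Multiplication by f turns an expression of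
     c over [l] modulo I2 into one of fc modulo I. *)
  pose s := s1 ++ gs ++ [seq f * y | y <- l].
  exists s => [y|b bI].
    rewrite !mem_cat => /or3P[/s1I//|/gsG|/mapP[z /lI2 zI2 ->] h].
      exact: inv0_mod.
    apply: (ideal_cong I_ideal (y := f * T h z)); first exact: T_leibniz.
    exact: zI2.
  have [b1 gb1 [c Ic]] := s1g b bI.
  have /sl := div_inv _ _ _ bI (gen_inv Ist s1I gb1) Ic.
  suff gc d : spanmod (M := B^o) (gen_subalg psi gs)
      (fun b => inv_mod I2 b /\ I2 b) l d ->
      exists2 d', gen_subalg psi s d' & I (f * d - d').
    move=> /gc[d gd Id]; exists (b1 + d).
      apply: (subringD (gen_subring _ _)) => //.
      by apply: gen_sub_seq gb1 => y ys; rewrite mem_cat ys.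
    rewrite opprD addrA; apply: (ideal_trans I_ideal (y := f * c)) Id.
    exact: Ic.
  elim=> {d} [d [_ Id]|e y d ge yl _ [d' gd' Id']].
    by exists 0; [apply: (subring0 (gen_subring _ _))|rewrite subr0].
  exists (e * (f * y) + d').
    apply: (subringD (gen_subring _ _)) => //; apply: gen_mul.
      by apply: gen_sub_seq ge => z zg; rewrite !mem_cat zg orbT.
    by apply: gen_mem; rewrite !mem_cat map_f ?orbT.
  by rewrite mulrDr -[e *: y]/(e * y) mulrCA opprD addrACA subrr add0r.
(* Otherwise b - b1 = fc with c invariant modulo I and of smaller degree. *)
have {}I2I b : I2 b -> I b.
  by move=> I2b; apply: contrapT => nIb; apply: I2I; exists b.
(* With homogeneous generators the generated algebra contains the components of its elements, as
   needed for [hc m b1] below. *)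
have [s [sI sh s1s]] := homog_gens Ist Igr s1I.
have gr := gen_subring psi (f :: s).
have fsI x : x \in f :: s -> inv_mod I x.
  by rewrite in_cons => /predU1P[->//|/sI].
have fsh x : x \in f :: s -> exists n, hc n x = x.
  by rewrite in_cons => /predU1P[->|/sh//]; exists n.
have gen1 b : gen_subalg psi s1 b -> gen_subalg psi (f :: s) b.
  apply: gen_min => //; first exact: gen_scalar.
  by move=> x /s1s; apply: gen_sub_seq => y ys; rewrite in_cons ys orbT.
exists (f :: s) => // b bI.
suff hom m c : inv_mod I c -> hc m c = c ->
    exists2 c', gen_subalg psi (f :: s) c' & I (c - c').
  have [N bN] := hc_sum b; rewrite bN.
  elim/big_rec: _ => [|i x _ [x' gx' Ix]].
    by exists 0; [apply: (subring0 gr)|rewrite subrr; apply: ideal0].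
  have [||c gc Ic] := hom i (hc i b); first by move=> h; rewrite -hcT; apply/Igr/bI.
    by rewrite hc_hc eqxx.
  exists (c + x'); first exact: (subringD gr).
  by rewrite opprD addrACA; apply: idealD.
elim/ltn_ind: m c => {b bI} m IHm b bI bm.
have [b1 gb1 [c Ic]] := s1g b bI.
have cI h : I (T h c) by apply: I2I; apply: (div_inv _ _ _ bI (gen_inv Ist s1I gb1) Ic).
(* The degree m component of b - b1 - fc is b minus that of b1 minus f times the component of c of
   degree m - n, the last term being absent when m < n. As n > 0, the induction on degree applies to
   that component of c. *)
have := Igr m _ Ic; rewrite 2!hcB bm (hcM_homog fn).
have gm : gen_subalg psi (f :: s) (hc m b1) by apply: gen_hc => //; apply: gen1.
case: leqP => [le_nm Im|_]; last by rewrite subr0; exists (hc m b1).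
have [|||d gd Id] := IHm (m - n)%N _ (hc (m - n) c).
- by rewrite ltn_subrL n_gt0 (leq_trans n_gt0).
- by move=> h; rewrite -hcT; apply: Igr.
- by rewrite hc_hc eqxx.
exists (hc m b1 + f * d).
  by apply: (subringD gr) => //; apply: gen_mul => //; apply/gen_mem/mem_head.
rewrite opprD addrA; apply: (ideal_trans I_ideal (y := f * hc (m - n) c)).
  exact: Im.
by rewrite -mulrBr; apply: ideal_mull.
Qed.

End GradedInvariants.

(** * H-algebras and their quotients *)

Section Actions.
Variables (A : comPzRingType) (H : bialgebra A).

Lemma hactB (M : hModType H) h (x y : M) : hact h (x - y) = hact h x - hact h y.
Proof. by rewrite hactDr hactN. Qed.

Lemma hact0l (M : hModType H) (m : M) : hact (0 : H) m = 0.
Proof. by apply: (@addrI _ (hact (0 : H) m)); rewrite -hactDl !addr0. Qed.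

Lemma hact_sum (M : hModType H) h I (r : seq I) (F : I -> M) :
  hact h (\sum_(i <- r) F i) = \sum_(i <- r) hact h (F i).
Proof.
elim/big_rec2: _ => [|i x y _ <-]; first exact: (hact0 M h).
by rewrite hactDr.
Qed.

End Actions.

(** Compatibility with products is stated by Sweedler's formula h(bc) = sum (h' b)(h'' c), where
    delta h = sum h' (x) h''. This can be checked directly on quotients and on coefficients of
    polynomials. *)
HB.factory Record isHAlgebra_delta (A : comPzRingType) (H : bialgebra A) C
    of HModule A H C & PzAlgebra A C := {
  hact_alg_in_subproof : forall (a : A) (c : C),
    hact (alg_in a : H) c = alg_in a * c;
  hact_unit_subproof : forall (h : H) (a : A),
    hact h (alg_in a : C) = alg_in (eps H h * a);
  hact_mul_subproof : forall (h : H) (b c : C), hact h (b * c) =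
    tlift (fun g g' : alg_amod H => hact (g : H) b * hact (g' : H) c) (delta H h)
}.

HB.builders Context A H C of isHAlgebra_delta A H C.

Fact hunit_hlinear : hlinear (H := H) (fun a : A^o => alg_in (a : A) : C).
Proof.
split=> [a b|h a]; first by rewrite rmorphD.
by rewrite hact_unit_subproof.
Qed.

Let scaleE (a : A) (c : hmod_amod C) : a *: c = (alg_in a : C) * (c : C).
Proof. exact: hact_alg_in_subproof. Qed.

Let mul_bal : balanced (fun b c : hmod_amod C => (b : C) * (c : C)).
Proof.
split=> [b b' c|b c c'|a b c]; rewrite ?mulrDl ?mulrDr //.
by rewrite !scaleE mulrA -(alg_in_comm a (b : C)).
Qed.

Let act_bal (b c : C) :
  balanced (fun g g' : alg_amod H => hact (g : H) b * hact (g' : H) c).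
Proof.
split=> [g k g'|g g' k|a g g'].
- by rewrite hactDl mulrDl.
- by rewrite hactDl mulrDr.
- by rewrite !hactZl !scaleE mulrA -(alg_in_comm a).
Qed.

Fact hmul_hlinear :
  hlinear (H := H) (tlift (fun b c : hmod_amod C => (b : C) * (c : C))).
Proof.
split=> [x y|h x]; first exact: tliftD.
elim/tens_ind: x => [|b c x IH].
  by rewrite [hact h 0]hact0 !tlift0 // hact0.
rewrite hactDr !tliftD // IH hactDr tlift_pure // hact_mul_subproof.
congr (_ + _); rewrite [hact h _]/(tens_act h _) /tens_act.
elim/tens_ind: (delta H h) => [|g g' y IHy].
  by rewrite tens_act2_0x !tlift0.
by rewrite tens_act2Dl !tliftD // IHy tens_act2_pure !tlift_pure.
Qed.

HB.instance Definition _ := isHAlgebra.Build A H C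
  hact_alg_in_subproof hunit_hlinear hmul_hlinear.

HB.end.

Section HAlgebraTheory.
Variables (A : comPzRingType) (H : bialgebra A) (C : hAlgType H).
Implicit Types (b c : C) (h : H).

Local Notation HH := (tens (alg_amod H) (alg_amod H)).

Definition act_prod b c (g g' : alg_amod H) : C :=
  hact (g : H) b * hact (g' : H) c.

Lemma halg_scaleE (a : A) (c : hmod_amod C) : a *: c = (alg_in a : C) * (c : C).
Proof. exact: hact_alg_in. Qed.

Lemma act_prod_balanced b c : balanced (act_prod b c).
Proof.
rewrite /act_prod; split=> [g k g'|g g' k|a g g'].
- by rewrite hactDl mulrDl.
- by rewrite hactDl mulrDr.
- by rewrite !hactZl !halg_scaleE mulrA -(alg_in_comm a).
Qed.

Lemma hactM h b c : hact h (b * c) = tlift (act_prod b c) (delta H h).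
Proof.
have mul_bal : balanced (fun b c : hmod_amod C => (b : C) * (c : C)).
  split=> [x y z|x y z|a x y]; rewrite ?mulrDl ?mulrDr //.
  by rewrite !halg_scaleE mulrA -(alg_in_comm a (x : C)).
have [_ /(_ h ((b : hmod_amod C) \ot (c : hmod_amod C)))] := @hmul_hlinear A H C.
rewrite [X in _ = hact h X -> _](tlift_pure mul_bal) => <-.
rewrite [hact h _]/(tens_act h _) /tens_act.
have bal := act_prod_balanced b c.
elim/tens_ind: (delta H h) => [|g g' y IHy].
  by rewrite tens_act2_0x !tlift0.
by rewrite tens_act2Dl !tliftD // IHy tens_act2_pure !tlift_pure.
Qed.

Lemma hact_unit h (a : A) : hact h (alg_in a : C) = alg_in (eps H h * a).
Proof. by have [_ <-] := @hunit_hlinear A H C. Qed.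

Definition defect h c : C := hact h c - alg_in (eps H h) * c.

Lemma defectB h b c : defect h (b - c) = defect h b - defect h c.
Proof.
rewrite /defect hactB mulrBr !opprB addrACA [RHS]addrACA.
by rewrite [- _ - _]addrC.
Qed.

Lemma defect_unit h (a : A) : defect h (alg_in a) = 0.
Proof. by rewrite /defect hact_unit rmorphM subrr. Qed.

Lemma invariant_defect c :
  c \in is_invariant C <-> forall h, defect h c = 0.
Proof.
split=> [/invariantP Ic h|Ic].
  by rewrite /defect Ic halg_scaleE subrr.
by apply/invariantP => h; apply/subr0_eq; rewrite halg_scaleE; apply: Ic.
Qed.

End HAlgebraTheory.

Definition hact_closed (A : comPzRingType) (H : bialgebra A) (M : hModType H)
  (N : M -> Prop) : Prop := forall h m, N m -> N (hact h m).

Lemma T_stable_hact (A : comPzRingType) (H : bialgebra A) (C : comHAlgType H)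
  (J : C -> Prop) : T_stable (@defect A H C) J <-> is_ideal J /\ hact_closed J.
Proof.
split=> -[J_ideal J_st]; split=> // h c Jc.
  apply: (ideal_cong J_ideal (J_st h c Jc)).
  exact: (ideal_mull J_ideal).
by apply: (idealB J_ideal); [apply: J_st|apply: (ideal_mull J_ideal)].
Qed.

(** By the left counit law h = sum eps(h') h'', so h(fb) - f (h b) is the sum of the terms (h' f -
    eps(h') f)(h'' b). Each first factor is a defect of f and lies in J. The two terms with eps(h) f
    b cancel. *)
Lemma defect_leibniz (A : comPzRingType) (H : bialgebra A) (C : comHAlgType H)
    (J : C -> Prop) : T_stable (@defect A H C) J ->
  forall f b h, inv_mod (@defect A H C) J f ->
    J (defect h (f * b) - f * defect h b).
Proof.
move=> [J_ideal _] f b h fJ.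
have -> : defect h (f * b) - f * defect h b = hact h (f * b) - f * hact h b.
  by rewrite /defect mulrBr mulrCA opprB addrA subrK.
rewrite hactM -[h in f * hact h b](eps_counitl (h : alg_amod H)).
have bal := act_prod_balanced f b.
have eps_bal : balanced (fun g g' : alg_amod H => eps H g *: g').
  split=> [g k g'|g g' k|a g g']; rewrite ?rmorphD ?scalerDl ?scalerDr //.
  have -> : eps H (a *: g : alg_amod H) = a * eps H g by rewrite rmorphM eps_in.
  by rewrite scalerA mulrC.
elim/tens_ind: (delta H h) => [|g g' x IH].
  rewrite !tlift0 // [hact _ b]hact0l mulr0 subrr.
  exact: (ideal0 J_ideal).
rewrite !tliftD // hactDl mulrDr opprD addrACA.
apply: (idealD J_ideal) => //; rewrite !tlift_pure // hactZl.
rewrite halg_scaleE mulrA [f * _]mulrC /act_prod -mulrBl.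
by apply: (ideal_mulr J_ideal); apply: fJ.
Qed.

(** * Quotients of commutative H-algebras by stable ideals *)

Record stable_ideal (A : comPzRingType) (H : bialgebra A) (C : comHAlgType H) :=
  StableIdeal {
    ideal_pred :> C -> Prop;
    ideal_predP : is_ideal ideal_pred;
    ideal_pred_hact : hact_closed ideal_pred
  }.

Section Quotient.
Variables (A : comPzRingType) (H : bialgebra A) (C : comHAlgType H).
Local Open Scope quotient_scope.
Variable J : stable_ideal C.

Let J_ideal := ideal_predP J.

Definition quot_rel : rel C := fun x y => `[< J (x - y) >].

Fact quot_rel_equiv : equiv_class_of quot_rel.
Proof.
split=> [x|x y|y x z].
- by apply/asboolP; rewrite subrr; apply: (ideal0 J_ideal).
- by apply/asboolP/asboolP => Jxy; rewrite -opprB; apply: (idealN J_ideal).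
- move=> /asboolP Jxy /asboolP Jyz; apply/asboolP.
  exact: (ideal_trans J_ideal Jxy Jyz).
Qed.

Canonical quot_equiv := EquivRelPack quot_rel_equiv.

Definition halg_quot : Type := {eq_quot quot_equiv}.
HB.instance Definition _ := EqQuotient.on halg_quot.
HB.instance Definition _ := Choice.on halg_quot.

Definition quot_pi (x : C) : halg_quot := \pi_halg_quot x.

Lemma quot_piP x y : quot_pi x = quot_pi y <-> J (x - y).
Proof. by split=> [/eqmodP/asboolP//|Jxy]; apply/eqmodP/asboolP. Qed.

Lemma quot_piK (x : halg_quot) : quot_pi (repr x) = x.
Proof. exact: reprK. Qed.

Let reprP x : J (repr (quot_pi x) - x).
Proof. by apply/quot_piP/quot_piK. Qed.

Let zero : halg_quot := quot_pi 0.
Let one : halg_quot := quot_pi 1.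
Let add (x y : halg_quot) := quot_pi (repr x + repr y).
Let opp (x : halg_quot) := quot_pi (- repr x).
Let mul (x y : halg_quot) := quot_pi (repr x * repr y).
Let act (h : H) (x : halg_quot) := quot_pi (hact h (repr x)).

Let addE x y : add (quot_pi x) (quot_pi y) = quot_pi (x + y).
Proof.
by apply/quot_piP; rewrite opprD addrACA; apply: (idealD J_ideal); apply: reprP.
Qed.

Let oppE x : opp (quot_pi x) = quot_pi (- x).
Proof.
by apply/quot_piP; rewrite -opprD; apply: (idealN J_ideal); apply: reprP.
Qed.

Let mulE x y : mul (quot_pi x) (quot_pi y) = quot_pi (x * y).
Proof.
apply/quot_piP; apply: (ideal_trans J_ideal (y := x * repr (quot_pi y))).
  by rewrite -mulrBl; apply: (ideal_mulr J_ideal); apply: reprP.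
by rewrite -mulrBr; apply: (ideal_mull J_ideal); apply: reprP.
Qed.

Let actE h x : act h (quot_pi x) = quot_pi (hact h x).
Proof.
by apply/quot_piP; rewrite -hactB; apply: ideal_pred_hact; apply: reprP.
Qed.

Let quotP (P : halg_quot -> Prop) : (forall x, P (quot_pi x)) -> forall x, P x.
Proof. by move=> PP x; rewrite -(quot_piK x). Qed.

Fact quot_addA : associative add.
Proof.
by do 3![elim/quotP=> ?]; rewrite !addE addrA.
Qed.

Fact quot_addC : commutative add.
Proof. by do 2![elim/quotP=> ?]; rewrite !addE addrC. Qed.

Fact quot_add0 : left_id zero add.
Proof. by elim/quotP=> ?; rewrite addE add0r. Qed.

Fact quot_addN : left_inverse zero opp add.
Proof. by elim/quotP=> ?; rewrite oppE addE addNr. Qed.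

HB.instance Definition _ :=
  GRing.isZmodule.Build halg_quot quot_addA quot_addC quot_add0 quot_addN.

Fact quot_mulA : associative mul.
Proof. by do 3![elim/quotP=> ?]; rewrite !mulE mulrA. Qed.

Fact quot_mulC : commutative mul.
Proof. by do 2![elim/quotP=> ?]; rewrite !mulE mulrC. Qed.

Fact quot_mul1 : left_id one mul.
Proof. by elim/quotP=> ?; rewrite mulE mul1r. Qed.

Fact quot_mulDl : left_distributive mul +%R.
Proof.
by do 3![elim/quotP=> ?]; rewrite [_ + _]addE !mulE [RHS]addE mulrDl.
Qed.

HB.instance Definition _ := GRing.Zmodule_isComPzRing.Build halg_quot
  quot_mulA quot_mulC quot_mul1 quot_mulDl.

Fact quot_pi_zmod_morphism : zmod_morphism quot_pi.
Proof. by move=> x y; rewrite [in RHS]/GRing.opp /= oppE [RHS]addE. Qed.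

Fact quot_pi_monoid_morphism : monoid_morphism quot_pi.
Proof. by split=> // x y; rewrite [RHS]mulE. Qed.

HB.instance Definition _ :=
  GRing.isZmodMorphism.Build C halg_quot quot_pi quot_pi_zmod_morphism.
HB.instance Definition _ :=
  GRing.isMonoidMorphism.Build C halg_quot quot_pi quot_pi_monoid_morphism.

Let alg_in_quot : {rmorphism A -> halg_quot} := quot_pi \o (alg_in : {rmorphism A -> C}).

Fact alg_in_quot_comm a (x : halg_quot) : alg_in_quot a * x = x * alg_in_quot a.
Proof. exact: mulrC. Qed.

HB.instance Definition _ := isPzAlgebra.Build A halg_quot alg_in_quot_comm.

Fact quot_actA g h x : act g (act h x) = act (g * h) x.
Proof. by elim/quotP: x => x; rewrite !actE hactA. Qed.

Fact quot_act1 x : act 1 x = x.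
Proof. by elim/quotP: x => x; rewrite !actE hact1. Qed.

Fact quot_actDl g h x : act (g + h) x = act g x + act h x.
Proof. by elim/quotP: x => x; rewrite !actE hactDl rmorphD. Qed.

Fact quot_actDr h x y : act h (x + y) = act h x + act h y.
Proof.
by elim/quotP: x => x; elim/quotP: y => y; rewrite -rmorphD !actE hactDr rmorphD.
Qed.

HB.instance Definition _ := isHModule.Build A H halg_quot
  quot_actA quot_act1 quot_actDl quot_actDr.

Lemma quot_pi_hact h x : quot_pi (hact h x) = hact h (quot_pi x).
Proof. by rewrite [RHS]actE. Qed.

Fact quot_act_alg_in (a : A) (x : halg_quot) :
  hact (alg_in a : H) x = alg_in a * x.
Proof.
by elim/quotP: x => x; rewrite -quot_pi_hact hact_alg_in rmorphM.
Qed.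

Fact quot_act_unit (h : H) (a : A) :
  hact h (alg_in a : halg_quot) = alg_in (eps H h * a).
Proof.
by rewrite -[LHS]/(hact h (quot_pi (alg_in a))) -quot_pi_hact hact_unit.
Qed.

Fact quot_act_mul (h : H) (x y : halg_quot) : hact h (x * y) =
  tlift (fun g g' : alg_amod H => hact (g : H) x * hact (g' : H) y) (delta H h).
Proof.
elim/quotP: x => x; elim/quotP: y => y.
rewrite -rmorphM -quot_pi_hact hactM /tlift rmorph_sum.
apply: eq_bigr => -[g g'] _ /=; by rewrite rmorphM /= !quot_pi_hact.
Qed.

HB.instance Definition _ := isHAlgebra_delta.Build A H halg_quot
  quot_act_alg_in quot_act_unit quot_act_mul.

Lemma quot_pi_defect h x :
  quot_pi (defect h x) = defect h (quot_pi x : HAlgebra.clone A H halg_quot _).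
Proof. by rewrite /defect rmorphB rmorphM /= quot_pi_hact. Qed.

Lemma quot_pi_morphism : halg_morphism quot_pi.
Proof.
split; last exact: quot_pi_monoid_morphism.
by split=> [x y|h x]; [rewrite rmorphD|rewrite quot_pi_hact].
Qed.

End Quotient.

(** This is adequacy for the projection from C to C/J, since the elements invariant modulo J are
    those whose classes are invariant in C/J. It supplies the hypothesis [T_power] of the graded
    argument. *)
Lemma adequate_power (A : comPzRingType) (H : bialgebra A) (C : comHAlgType H) :
  adequate H -> locally_finite C ->
  forall J, T_stable (@defect A H C) J ->
  forall f, inv_mod (@defect A H C) J f -> exists n g,
    [/\ (0 < n)%N, inv_mod (@defect A H C) (fun b => b = 0) g & J (g - f ^+ n)].
Proof.
move=> adH lfC J /[dup] Jst /T_stable_hact[J_ideal J_hact] f fJ.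
pose q := @quot_pi A H C (StableIdeal J_ideal J_hact).
have qf : q f \in is_invariant _.
  apply/invariant_defect => h; rewrite -quot_pi_defect.
  by apply/quot_piP; rewrite subr0; apply: fJ.
have [|n [g [n_gt0 gf]]] :=
    adH C _ q (quot_pi_morphism _) _ lfC (Invariant qf).
  by move=> d; exists (repr d); apply: quot_piK.
exists n, (inv_val g); split=> //; first exact/invariant_defect/inv_valP.
by have /quot_piP : q (inv_val g) = q (f ^+ n) by rewrite gf /q rmorphXn.
Qed.

(** * Locally finite H-modules *)

Notation lspan := (spanmod (fun=> True) (fun v => v = 0)).

Lemma trueP_subring (B : pzRingType) : is_subring (fun _ : B => True).
Proof. by []. Qed.

Lemma lspan_submod (B : comPzRingType) (M : lmodType B) (s : seq M) :
  is_submod (fun=> True) (lspan s).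
Proof. by apply: spanmod_submod => //; apply: submod_zero. Qed.

Lemma mem_lspan (B : comPzRingType) (M : lmodType B) (s : seq M) x :
  x \in s -> lspan s x.
Proof. by apply: spanmod_mem => //; apply: submod_zero. Qed.

Lemma finite_moduleP (B : comPzRingType) (V : lmodType B) :
  finite_module V <-> exists s : seq V, forall v, lspan s v.
Proof.
split=> -[s sV]; exists s => v.
  have [c ->] := sV v; apply: (submod_sum (lspan_submod s)) => i _.
  by apply: (submodZ (lspan_submod s)) => //; apply/mem_lspan/mem_nth.
elim: (sV v) => {v} [_ ->|a x v _ xs _ [c ->]].
  by exists (fun=> 0); rewrite big1 // => i _; rewrite scale0r.
exists (fun i => (if i == index x s then a else 0) + c i).
under [RHS]eq_bigr do rewrite /= scalerDl.
rewrite big_split /=; congr (_ + _).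
rewrite (bigD1 (Ordinal (etrans (index_mem x s) xs))) //= eqxx.
rewrite nth_index // big1 ?addr0 // => i.
by rewrite -val_eqE /= => /negPf->; rewrite scale0r.
Qed.

Section HSubmodule.
Variables (A : comPzRingType) (H : bialgebra A) (M : hModType H).

Record hsubmod := HSubmod {
  hsub_pred :> M -> Prop;
  hsub0 : hsub_pred 0;
  hsubB : forall x y, hsub_pred x -> hsub_pred y -> hsub_pred (x - y);
  hsub_hact : hact_closed hsub_pred
}.

Definition hsub_mem (N : hsubmod) : {pred M} := fun m => `[< N m >].

Record hsub (N : hsubmod) := HSub { hsub_val : M; _ : hsub_val \in hsub_mem N }.

Section Structure.
Variable N : hsubmod.

HB.instance Definition _ := [isSub for @hsub_val N].
HB.instance Definition _ := [Choice of hsub N by <:].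

Fact hsub_zmod_closed : zmod_closed (hsub_mem N).
Proof.
split=> [|x y /asboolP Nx /asboolP Ny]; apply/asboolP; first exact: hsub0.
exact: hsubB.
Qed.

HB.instance Definition _ := GRing.SubChoice_isSubZmodule.Build M (hsub_mem N)
  (hsub N) hsub_zmod_closed.

Lemma hsub_valP (x : hsub N) : N (hsub_val x).
Proof. by apply/asboolP; case: x. Qed.

Definition to_hsub m (Nm : N m) : hsub N := HSub (asboolT Nm : m \in hsub_mem N).

Definition hsub_act (h : H) (x : hsub N) : hsub N :=
  to_hsub (hsub_hact h (hsub_valP x)).

Fact hsub_actA g h x : hsub_act g (hsub_act h x) = hsub_act (g * h) x.
Proof. by apply: val_inj; rewrite /= hactA. Qed.

Fact hsub_act1 x : hsub_act 1 x = x.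
Proof. by apply: val_inj; rewrite /= hact1. Qed.

Fact hsub_actDl g h x : hsub_act (g + h) x = hsub_act g x + hsub_act h x.
Proof. by apply: val_inj; rewrite /= hactDl. Qed.

Fact hsub_actDr h x y : hsub_act h (x + y) = hsub_act h x + hsub_act h y.
Proof. by apply: val_inj; rewrite /= hactDr. Qed.

HB.instance Definition _ := isHModule.Build A H (hsub N)
  hsub_actA hsub_act1 hsub_actDl hsub_actDr.

End Structure.
End HSubmodule.

Section LocallyFinite.
Variables (A : comPzRingType) (H : bialgebra A) (M : hModType H).

Local Notation aspan := (lspan : seq (hmod_amod M) -> M -> Prop).

(** An elementary form of local finiteness, equivalent to the filtered colimit by the two
    implications below. *)
Definition elementwise_finite : Prop :=
  forall m : M, exists s : seq (hmod_amod M), aspan s m /\ hact_closed (aspan s).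

Lemma aspan_hact_closed s :
  (forall h x, x \in s -> aspan s (hact h (x : M))) -> hact_closed (aspan s).
Proof.
move=> sh h v; elim=> {v} [_ ->|a y v _ ys _ IH].
  by rewrite hact0; apply: (submod0 (lspan_submod _)).
rewrite hactDr; apply: (submodD (lspan_submod _)) => //.
by rewrite hactZr; apply: (submodZ (lspan_submod _)) => //; apply: sh.
Qed.

Lemma hlinear0 (N N' : hModType H) (f : N -> N') : hlinear f -> f 0 = 0.
Proof. by case=> fD _; apply: (@addrI _ (f 0)); rewrite -fD !addr0. Qed.

Lemma hlinearB (N N' : hModType H) (f : N -> N') :
  hlinear f -> forall x y, f (x - y) = f x - f y.
Proof.
move=> [fD _] x y; apply: (@addIr _ (f y)).
by rewrite -fD !subrK.
Qed.

(** The images of the objects of the diagram form a submodule U, by filteredness. The universal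
    property gives a map from M to U, and uniqueness shows that its composite with the inclusion is
    the identity, so U = M. Each m thus lies in the image of a single finite object, and that image
    is stable. *)
Lemma locally_finite_elementwise : locally_finite M -> elementwise_finite.
Proof.
move=> [J [D [c [[[i0] J2 J3] Dfin [[c_lin c_comp] univ]]]]].
pose im (m : M) := exists i (x : D i), c i x = m.
have im0 : im 0 by exists i0, 0; apply: hlinear0.
have imB x y : im x -> im y -> im (x - y).
  move=> [i [x' <-]] [j [y' <-]]; have [k [[u] [v]]] := J2 i j.
  exists k, (dmap u x' - dmap v y').
  by rewrite (hlinearB (c_lin k)) !c_comp.
have im_hact : hact_closed im.
  move=> h _ [i [x <-]]; exists i, (hact h x).
  by case: (c_lin i) => _ ->.
pose U := HSubmod im0 imB im_hact.
pose d i (x : D i) : hsub U := to_hsub (N := U) (ex_intro _ i (ex_intro _ x erefl)).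
have d_cocone : is_cocone d.
  split=> [i|i j u x]; last by apply: val_inj; rewrite /= c_comp.
  have [cD cH] := c_lin i.
  by split=> [x y|h x]; apply: val_inj; rewrite /= ?cD ?cH.
have [f [[[fD fH] fc] _]] := univ _ d d_cocone.
have [g [_ gU]] := univ M c (conj c_lin c_comp).
have valf m : hsub_val (f m) = m.
  have -> : hsub_val (f m) = g m.
    rewrite (gU (fun m => hsub_val (f m))) //; split; last by move=> i x; rewrite fc.
    by split=> [x y|h x]; rewrite ?fD ?fH.
  by rewrite (gU id).
move=> m; have [i [x cx]] : im m by rewrite -(valf m); apply: (hsub_valP (N := U)).
have [s sD] := (finite_moduleP _).1 (Dfin i).
have cs y : aspan [seq c i z | z <- s] (c i y).
  have [cD cH] := c_lin i.
  elim: (sD y) => {y} [_ ->|a z y _ zs _ IH].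
    by rewrite (hlinear0 (c_lin i)); apply: (submod0 (lspan_submod _)).
  rewrite cD; apply: (submodD (lspan_submod _)) => //.
  rewrite [c i _]cH; apply: (submodZ (lspan_submod _)) => //.
  by apply: mem_lspan; apply: map_f.
exists [seq c i z | z <- s]; split; first by rewrite -cx.
apply: aspan_hact_closed => h _ /mapP[z zs ->].
by case: (c_lin i) => _ <-; apply: cs.
Qed.

Lemma hsub_span_finite (N : hsubmod M) (s : seq (hmod_amod M)) :
  (forall m, N m <-> aspan s m) -> finite_hmodule (hsub N).
Proof.
move=> Ns; apply/finite_moduleP.
have [|t [st _]] := @seq_exists (hmod_amod M) (hsub N) (fun x y => hsub_val y = x) s.
  by move=> x /mem_lspan/Ns Nx; exists (to_hsub Nx).
exists (t : seq (hmod_amod (hsub N))) => y.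
suff gen m : aspan s m -> forall y, hsub_val y = m ->
    (lspan : seq (hmod_amod (hsub N)) -> hmod_amod (hsub N) -> Prop) t y.
  exact: gen ((Ns _).1 (hsub_valP y)) _ erefl.
elim=> {y m} [_ ->|a x m _ /st[z zt zx] sm IH] y ym.
  have -> : y = 0 by apply: val_inj.
  exact: (submod0 (lspan_submod _)).
have Nm : N m by apply/Ns.
have -> : y = (a *: (z : hmod_amod (hsub N)) : hsub N) + to_hsub Nm.
  by apply: val_inj; rewrite /= ym -zx.
apply: (submodD (lspan_submod _)); last exact: IH.
by apply: (submodZ (lspan_submod _)) => //; apply: mem_lspan.
Qed.

(** M is the filtered union of its stable finitely generated submodules. The index category is the
    preorder of lists with stable span; proof irrelevance gives the category laws, and concatenation
    gives upper bounds. *)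
Lemma elementwise_locally_finite : elementwise_finite -> locally_finite M.
Proof.
move=> Mfin.
pose J := {s : seq (hmod_amod M) | hact_closed (aspan s)}.
pose le (s t : J) : Prop := forall m, aspan (sval s) m -> aspan (sval t) m.
pose cat : category := @Category J le (fun s m sm => sm)
  (fun s t u tu st m sm => tu m (st m sm))
  (fun _ _ _ => Prop_irrelevance _ _) (fun _ _ _ => Prop_irrelevance _ _)
  (fun _ _ _ _ _ _ _ => Prop_irrelevance _ _).
have sB (s : J) x y : aspan (sval s) x -> aspan (sval s) y -> aspan (sval s) (x - y).
  by move=> sx sy; apply: (submodB _ (lspan_submod _)).
pose N (s : J) : hsubmod M :=
  HSubmod (submod0 (lspan_submod (sval s))) (@sB s) (svalP s).
pose up (s t : J) (st : le s t) (x : hsub (N s)) : hsub (N t) :=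
  to_hsub (N := N t) (st _ (hsub_valP x)).
have up_lin s t st : hlinear (@up s t st).
  by split=> [x y|h x]; apply: val_inj.
have up_id s x : @up s s (@idm cat s) x = x by apply: val_inj.
have up_comp s t u (tu : @Defs.hom cat t u) (st : @Defs.hom cat s t) x :
  up s u (Defs.comp tu st) x = up t u tu (up s t st x) by apply: val_inj.
pose D : diagram H cat := Diagram (J := cat) up_lin up_id up_comp.
have join (s t : cat) : exists2 u : cat, le s u & le t u.
  case: s t => [s ss] [t st].
  have cl : hact_closed (aspan (s ++ t)).
    have sub u : {subset u <= s ++ t} -> hact_closed (aspan u) ->
        forall h x, x \in u -> aspan (s ++ t) (hact h x).
      move=> us cu h x /mem_lspan/(cu h).
      by apply: spanmod_sub.
    apply: aspan_hact_closed => h y.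
    rewrite mem_cat => /orP[].
      by apply: (sub s) => // x; rewrite mem_cat => ->.
    by apply: (sub t) => // x; rewrite mem_cat orbC => ->.
  exists (exist _ (s ++ t) cl) => m /=.
    by apply: spanmod_sub => // x; rewrite mem_cat => ->.
  by apply: spanmod_sub => // x; rewrite mem_cat orbC => ->.
exists cat, D, (fun s (x : D s) => hsub_val x); split.
- split.
  + by have [s [_ ss]] := Mfin 0; constructor; exists s.
  + by move=> s t; have [u su tu] := join s t; exists u; split; constructor.
  + by move=> s t u v; exists t, (@idm cat t); apply: (@Prop_irrelevance (le s t)).
- by move=> s; apply: (@hsub_span_finite (N s) (sval s)).
- split.
    by split=> [s|s t u x //]; split.
  move=> P d [d_lin d_comp].
  have [S SP] := choice Mfin.
  pose o m : J := exist _ (S m) (SP m).2.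
  pose f m : P := d (o m) (to_hsub (N := N (o m)) (SP m).1).
  (* The map [f] uses a chosen stable submodule around each element; comparison inside a common
     upper bound shows that the choice does not matter. *)
  have dE s t (x : D s) (y : D t) : hsub_val x = hsub_val y -> d s x = d t y.
    move=> xy; have [u su tu] := join s t.
    rewrite -(d_comp s u su) -(d_comp t u tu); congr (d u _).
    exact: val_inj.
  have fE s (x : D s) : f (hsub_val x) = d s x by apply: dE.
  exists f; split=> [|g [_ gE]]; last first.
    by apply/funext => m; rewrite /f -gE.
  split=> //; split=> [x y|h x].
    have [u xu yu] := join (o x) (o y).
    have ux : aspan (sval u) x by apply/xu/(SP x).1.
    have uy : aspan (sval u) y by apply/yu/(SP y).1.
    pose x' : D u := to_hsub (N := N u) ux; pose y' : D u := to_hsub (N := N u) uy.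
    have -> : x + y = hsub_val (x' + y') by [].
    by rewrite fE (d_lin u).1 -!fE.
  pose x' : D (o x) := to_hsub (N := N (o x)) (SP x).1.
  have -> : hact h x = hsub_val (hact h x') by [].
  by rewrite fE (d_lin _).2 -!fE.
Qed.

End LocallyFinite.

(** * The Rees algebra of a filtration *)

(* {poly B} requires a nonzero ring, so the assumption 1 != 0 is made part of
   the type. *)
Definition nz_copy (B : comPzRingType) (nz : (1 : B) != 0) : Type := B.

HB.instance Definition _ (B : comPzRingType) (nz : (1 : B) != 0) :=
  GRing.ComPzRing.copy (nz_copy nz) B.
HB.instance Definition _ (B : comPzRingType) (nz : (1 : B) != 0) :=
  GRing.PzSemiRing_isNonZero.Build (nz_copy nz) nz.

Record filtration (A : comPzRingType) (H : bialgebra A) (C : comHAlgType H) :=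
  Filtration {
    fil :> nat -> C -> Prop;
    fil0 : forall n, fil n 0;
    filB : forall n x y, fil n x -> fil n y -> fil n (x - y);
    fil_hact : forall n, hact_closed (fil n);
    fil1 : fil 0%N 1;
    filM : forall m n x y, fil m x -> fil n y -> fil (m + n)%N (x * y)
  }.

Section Rees.
Variables (A : comPzRingType) (H : bialgebra A) (C : comHAlgType H).
Variables (nz : (1 : C) != 0) (F : filtration C).

Local Notation K := (nz_copy nz).

Definition rees_mem : {pred {poly K}} := fun p => `[< forall n, F n p`_n >].

Record rees := Rees { rees_val : {poly K}; _ : rees_val \in rees_mem }.

HB.instance Definition _ := [isSub for rees_val].
HB.instance Definition _ := [Choice of rees by <:].

Let filD n x y : F n x -> F n y -> F n (x + y).
Proof.
move=> Fx Fy; rewrite -[y]opprK -[- y]sub0r.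
by apply: filB => //; apply: filB => //; apply: fil0.
Qed.

Fact rees_subring_closed : subring_closed rees_mem.
Proof.
split=> [|p q /asboolP Fp /asboolP Fq|p q /asboolP Fp /asboolP Fq].
- apply/asboolP => -[|n]; rewrite coef1 /=; [exact: fil1|exact: fil0].
- by apply/asboolP => n; rewrite coefB; apply: filB.
- apply/asboolP => n; rewrite coefM; elim/big_ind: _ => [|x y|i _].
  + exact: fil0.
  + exact: filD.
  + by rewrite -{1}(subnKC (leq_ord i)); apply: filM.
Qed.

HB.instance Definition _ := GRing.SubChoice_isSubComPzRing.Build {poly K}
  rees_mem rees rees_subring_closed.

Lemma rees_coef (p : rees) n : F n (rees_val p)`_n.
Proof. by case: p => p /= /asboolP. Qed.

Definition to_rees (p : {poly K}) (Fp : forall n, F n p`_n) : rees :=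
  Rees (asboolT Fp : p \in rees_mem).

Lemma rees_eq (p q : rees) :
  (forall n, (rees_val p)`_n = (rees_val q)`_n) -> p = q.
Proof. by move=> pq; apply/val_inj/polyP. Qed.

Lemma coef_rees0 n : (rees_val (0 : rees))`_n = 0.
Proof. exact: coef0. Qed.

Lemma coef_reesB (p q : rees) n :
  (rees_val (p - q))`_n = (rees_val p)`_n - (rees_val q)`_n.
Proof. by rewrite coefB. Qed.

Lemma coef_reesM (p q : rees) n : (rees_val (p * q))`_n =
  \sum_(i < n.+1) (rees_val p)`_i * (rees_val q)`_(n - i).
Proof. by rewrite coefM. Qed.

Lemma coef_rees_sum I (r : seq I) (P : pred I) (E : I -> rees) n :
  (rees_val (\sum_(i <- r | P i) E i))`_n =
  \sum_(i <- r | P i) (rees_val (E i))`_n.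
Proof.
elim/big_rec2: _ => [|i x y _ <-]; first by rewrite coef0.
by rewrite coefD.
Qed.

Let act_poly (h : H) (p : {poly K}) : {poly K} :=
  \poly_(i < size p) (hact h (p`_i : C) : K).

Let coef_act h p n : (act_poly h p)`_n = hact h (p`_n : C).
Proof.
rewrite coef_poly; case: ltnP => // le_pn.
by rewrite nth_default // [RHS]hact0.
Qed.

Fact rees_act_subproof h (p : rees) n : F n (act_poly h (rees_val p))`_n.
Proof. by rewrite coef_act; apply/fil_hact/rees_coef. Qed.

Definition rees_act h (p : rees) : rees := to_rees (rees_act_subproof h p).

Lemma coef_rees_act h p n :
  (rees_val (rees_act h p))`_n = hact h ((rees_val p)`_n : C).
Proof. exact: coef_act. Qed.

Fact rees_actA g h p : rees_act g (rees_act h p) = rees_act (g * h) p.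
Proof. by apply: rees_eq => n; rewrite !coef_rees_act hactA. Qed.

Fact rees_act1 p : rees_act 1 p = p.
Proof. by apply: rees_eq => n; rewrite !coef_rees_act hact1. Qed.

Fact rees_actDl g h p : rees_act (g + h) p = rees_act g p + rees_act h p.
Proof. by apply: rees_eq => n; rewrite [in RHS]coefD !coef_rees_act hactDl. Qed.

Fact rees_actDr h p q : rees_act h (p + q) = rees_act h p + rees_act h q.
Proof.
by apply: rees_eq => n; rewrite [in RHS]coefD !coef_rees_act coefD hactDr.
Qed.

HB.instance Definition _ := isHModule.Build A H rees
  rees_actA rees_act1 rees_actDl rees_actDr.

Lemma fil_alg_in a : F 0 (alg_in a : C).
Proof. by rewrite -[alg_in a]mulr1 -hact_alg_in; apply/fil_hact/fil1. Qed.

Fact rees_alg_subproof a n : F n ((alg_in a : K)%:P)`_n.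
Proof. by rewrite coefC; case: n => [|n]; [apply: fil_alg_in|apply: fil0]. Qed.

Definition rees_alg a : rees := to_rees (rees_alg_subproof a).

Fact rees_alg_zmod_morphism : zmod_morphism rees_alg.
Proof. by move=> a b; apply: val_inj; rewrite /= rmorphB polyCB. Qed.

Fact rees_alg_monoid_morphism : monoid_morphism rees_alg.
Proof.
by split=> [|a b]; apply: val_inj; rewrite /= ?rmorph1 // rmorphM polyCM.
Qed.

HB.instance Definition _ :=
  GRing.isZmodMorphism.Build A rees rees_alg rees_alg_zmod_morphism.
HB.instance Definition _ :=
  GRing.isMonoidMorphism.Build A rees rees_alg rees_alg_monoid_morphism.

Fact rees_alg_comm a (p : rees) : rees_alg a * p = p * rees_alg a.
Proof. exact: mulrC. Qed.

HB.instance Definition _ := isPzAlgebra.Build A rees rees_alg_comm.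

Lemma coef_rees_hact h (p : rees) n :
  (rees_val (hact h p))`_n = hact h ((rees_val p)`_n : C).
Proof. exact: coef_act. Qed.

Fact rees_act_alg_in a (p : rees) : hact (alg_in a : H) p = alg_in a * p.
Proof.
by apply: rees_eq => n; rewrite coef_rees_hact hact_alg_in coefCM.
Qed.

Fact rees_act_unit h a : hact h (alg_in a : rees) = alg_in (eps H h * a).
Proof.
apply: rees_eq => n; rewrite coef_rees_hact !coefC.
by case: n => [|n] /=; rewrite ?hact_unit // hact0.
Qed.

Fact rees_act_mul h (p q : rees) : hact h (p * q) =
  tlift (fun g g' : alg_amod H => hact (g : H) p * hact (g' : H) q) (delta H h).
Proof.
apply: rees_eq => n; rewrite coef_rees_hact coefM hact_sum.
rewrite /tlift coef_rees_sum.
under [RHS]eq_bigr do rewrite coefM.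
rewrite exchange_big; apply: eq_bigr => i _ /=.
rewrite hactM; apply: eq_bigr => -[g g'] _.
by rewrite !coef_rees_hact.
Qed.

HB.instance Definition _ := isHAlgebra_delta.Build A H rees
  rees_act_alg_in rees_act_unit rees_act_mul.

End Rees.

Section ReesGrading.
Variables (A : comPzRingType) (H : bialgebra A) (C : comHAlgType H).
Variables (nz : (1 : C) != 0) (F : filtration C).

Local Notation K := (nz_copy nz).
Local Notation rees := (rees nz F).
Implicit Types (p q : rees) (x y : C).

Fact rmono_subproof n x : F n x -> forall j, F j ((x : K) *: 'X^n)`_j.
Proof.
move=> Fx j; rewrite coefZ coefXn; case: eqP => [->|_].
  by rewrite mulr1.
by rewrite mulr0; apply: fil0.
Qed.

(** The homogeneous element x t^n of the Rees algebra. *)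
Definition rmono n x (Fx : F n x) : rees := to_rees (rmono_subproof Fx).

Lemma coef_rmono n x (Fx : F n x) j :
  (rees_val (rmono Fx))`_j = if j == n then x : K else 0.
Proof. by rewrite coefZ coefXn; case: eqP; rewrite ?mulr1 ?mulr0. Qed.

Lemma rmono_eq m n x y (Fx : F m x) (Fy : F n y) :
  m = n -> x = y -> rmono Fx = rmono Fy.
Proof. by move=> mn xy; apply: rees_eq => j; rewrite !coef_rmono mn xy. Qed.

Lemma rmonoM m n x y (Fx : F m x) (Fy : F n y) :
  rmono Fx * rmono Fy = rmono (filM Fx Fy).
Proof.
apply: val_inj; rewrite /= -scalerAl -scalerAr -exprD scalerA.
by [].
Qed.

Lemma coef_reesZ (a : A) p j :
  (rees_val (a *: (p : hmod_amod rees)))`_j =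
    (alg_in a : C) * ((rees_val p)`_j : C).
Proof. by rewrite halg_scaleE -hact_alg_in coef_rees_hact hact_alg_in. Qed.

Lemma rmono_hact n x (Fx : F n x) h : hact h (rmono Fx) = rmono (fil_hact h Fx).
Proof.
apply: rees_eq => j; rewrite coef_rees_hact !coef_rmono.
by case: eqP => // _; rewrite hact0.
Qed.

Definition rees_hc n p : rees := rmono (rees_coef p n).

Lemma coef_rees_hc n p j :
  (rees_val (rees_hc n p))`_j = if j == n then (rees_val p)`_n else 0.
Proof. exact: coef_rmono. Qed.

Lemma coef_rees_defect h p n :
  (rees_val (defect h p))`_n = defect h ((rees_val p)`_n : C).
Proof. by rewrite coef_reesB coef_rees_hact coefCM. Qed.

Lemma rees_hcB n p q : rees_hc n (p - q) = rees_hc n p - rees_hc n q.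
Proof.
apply: rees_eq => j; rewrite coef_reesB !coef_rees_hc coef_reesB.
by case: eqP; rewrite ?subrr.
Qed.

Lemma rees_hc_hc m n p :
  rees_hc m (rees_hc n p) = if m == n then rees_hc n p else 0.
Proof.
apply: rees_eq => j; rewrite !coef_rees_hc.
by have [->|mn] := eqVneq m n; [rewrite coef_rees_hc|rewrite coef_rees0 if_same].
Qed.

Lemma rees_hcM n p q :
  rees_hc n (p * q) = \sum_(i < n.+1) rees_hc i p * rees_hc (n - i) q.
Proof.
apply: rees_eq => j; rewrite coef_rees_hc coef_rees_sum coef_reesM.
have -> : (if j == n then \sum_(i < n.+1) (rees_val p)`_i * (rees_val q)`_(n - i)
    else 0) = \sum_(i < n.+1) (if j == n then
      (rees_val p)`_i * (rees_val q)`_(n - i) else 0).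
  by case: eqP => // _; rewrite big1.
apply: eq_bigr => i _.
by rewrite rmonoM coef_rmono subnKC // -ltnS.
Qed.

Lemma rees_hc_sum p : exists n, p = \sum_(i < n.+1) rees_hc i p.
Proof.
exists (size (rees_val p)); apply: rees_eq => j; rewrite coef_rees_sum.
have [lt_jp|le_pj] := ltnP j (size (rees_val p)).+1.
  rewrite (bigD1 (Ordinal lt_jp)) //= coef_rees_hc eqxx big1 ?addr0 // => i.
  by rewrite -val_eqE /= coef_rees_hc eq_sym => /negPf->.
rewrite nth_default 1?ltnW // big1 // => i _.
rewrite coef_rees_hc; case: eqP => // ji.
by have := ltn_ord i; rewrite -ji ltnNge le_pj.
Qed.

Lemma coef_rees_alg_in (a : A) n :
  (rees_val (alg_in a : rees))`_n = if n == 0%N then alg_in a : K else 0.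
Proof. exact: coefC. Qed.

Lemma rees_hc_alg_in n (a : A) :
  rees_hc n (alg_in a) = if n == 0%N then alg_in a else 0.
Proof.
apply: rees_eq => j; rewrite coef_rees_hc coef_rees_alg_in.
by case: n => [|n]; rewrite ?coef_rees_alg_in ?coef_rees0 ?if_same.
Qed.

Lemma rees_hc_defect n h p : rees_hc n (defect h p) = defect h (rees_hc n p).
Proof.
apply: rees_eq => j; rewrite coef_rees_defect !coef_rees_hc coef_rees_defect.
by case: eqP => // _; rewrite /defect hact0 mulr0 subrr.
Qed.

Lemma rmono_defect n x (Fx : F n x) h j :
  (rees_val (defect h (rmono Fx)))`_j = if j == n then defect h x : K else 0.
Proof.
rewrite coef_rees_defect coef_rmono.
by case: eqP => // _; rewrite /defect hact0 mulr0 subrr.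
Qed.

Definition rees_ev p : C := (rees_val p).[1].

Lemma rees_evE p : rees_ev p = \sum_(i < size (rees_val p)) (rees_val p)`_i.
Proof.
rewrite /rees_ev horner_coef; apply: eq_bigr => i _.
by rewrite expr1n mulr1.
Qed.

Fact rees_ev_zmod_morphism : zmod_morphism rees_ev.
Proof. by move=> p q; rewrite /rees_ev /= hornerD hornerN. Qed.

Fact rees_ev_monoid_morphism : monoid_morphism rees_ev.
Proof. by split=> [|p q]; rewrite /rees_ev /= ?hornerC // hornerM. Qed.

HB.instance Definition _ :=
  GRing.isZmodMorphism.Build rees C rees_ev rees_ev_zmod_morphism.
HB.instance Definition _ :=
  GRing.isMonoidMorphism.Build rees C rees_ev rees_ev_monoid_morphism.

Lemma rees_ev_alg_in a : rees_ev (alg_in a) = alg_in a.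
Proof. by rewrite /rees_ev hornerC. Qed.

Lemma rees_ev_rmono n x (Fx : F n x) : rees_ev (rmono Fx) = x.
Proof. by rewrite /rees_ev hornerZ hornerXn expr1n mulr1. Qed.

(** By additivity it suffices to treat x t^n, for which both sides equal h x. *)
Lemma rees_ev_hact h p : rees_ev (hact h p) = hact h (rees_ev p).
Proof.
have [n {1 2}->] := rees_hc_sum p.
rewrite hact_sum !rmorph_sum hact_sum; apply: eq_bigr => i _ /=.
by rewrite rmono_hact !rees_ev_rmono.
Qed.

Lemma rees_ev_defect h p : rees_ev (defect h p) = defect h (rees_ev p).
Proof. by rewrite rmorphB rmorphM /= rees_ev_hact rees_ev_alg_in. Qed.

Section Coefficientwise.
Variable J : C -> Prop.
Hypothesis J_st : T_stable (@defect A H C) J.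

Definition rees_ideal p : Prop := forall n, J (rees_val p)`_n.

Let J_ideal : is_ideal J := J_st.1.

Lemma rees_ideal_stable : T_stable (@defect A H rees) rees_ideal.
Proof.
split=> [|h p Jp n]; last by rewrite coef_rees_defect; apply: J_st.2.
split=> [n|p q Jp Jq n|r p Jp n].
- by rewrite coef_rees0; apply: (ideal0 J_ideal).
- by rewrite coefD; apply: (idealD J_ideal).
- rewrite coef_reesM; apply: (ideal_sum J_ideal) => i _.
  exact: (ideal_mull J_ideal).
Qed.

Lemma rees_ideal_graded : graded rees_hc rees_ideal.
Proof.
move=> n p Jp j; rewrite coef_rees_hc.
by case: eqP => _; [apply: Jp|apply: (ideal0 J_ideal)].
Qed.

Lemma rees_ideal_ev p : rees_ideal p -> J (rees_ev p).
Proof.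
by move=> Jp; rewrite rees_evE; apply: (ideal_sum J_ideal) => i _; apply: Jp.
Qed.

(** An x in F_n that is invariant modulo J lifts to x t^n, which is invariant modulo [rees_ideal];
    setting t = 1 in an expression for the lift gives one for x. *)
Lemma rees_fg_mod (R : comPzRingType) (phi : {rmorphism R -> A}) :
  (forall x, exists n, F n x) ->
  fg_mod (alg_in \o phi : {rmorphism R -> rees})
    (inv_mod (@defect A H rees) rees_ideal) rees_ideal ->
  fg_mod (alg_in \o phi : {rmorphism R -> C}) (inv_mod (@defect A H C) J) J.
Proof.
move=> Fex [s sI sg].
exists [seq rees_ev p | p <- s] => [_ /mapP[p /sI pI ->] h|x xI].
  by rewrite -rees_ev_defect; apply: rees_ideal_ev; apply: pI.
have [n Fx] := Fex x.
have [|p gp Jp] := sg (rmono Fx).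
  move=> h j; rewrite rmono_defect.
  by case: eqP => _; [apply: xI|apply: (ideal0 J_ideal)].
exists (rees_ev p); last first.
  by rewrite -(rees_ev_rmono Fx) -rmorphB; apply: rees_ideal_ev.
elim: gp => {p Jp} [r|p ps|p q _ Ip _ Iq|p q _ Ip _ Iq].
- by rewrite /= rees_ev_alg_in; apply: (gen_scalar _ _ r).
- by apply: gen_mem; apply: map_f.
- by rewrite rmorphB; apply: gen_sub.
- by rewrite rmorphM; apply: gen_mul.
Qed.

End Coefficientwise.

End ReesGrading.

Lemma gen_rmorph (R B B' : comPzRingType) (f : {rmorphism R -> B})
    (g : {rmorphism B -> B'}) (s : seq B) t : {subset [seq g x | x <- s] <= t} ->
  forall b, gen_subalg f s b -> gen_subalg (g \o f : {rmorphism R -> B'}) t (g b).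
Proof.
move=> st b; elim=> {b} [r|x xs|x y _ IHx _ IHy|x y _ IHx _ IHy].
- exact: (gen_scalar _ _ r).
- by apply/gen_mem/st/map_f.
- by rewrite rmorphB; apply: gen_sub.
- by rewrite rmorphM; apply: gen_mul.
Qed.

(** * The filtration by powers of a stable finite span *)

Section GeneratedFiltration.
Variables (A : comPzRingType) (H : bialgebra A) (C : comHAlgType H).

Local Notation aspan := (lspan : seq (hmod_amod C) -> C -> Prop).
Implicit Types (s t : seq (hmod_amod C)).

Definition seq_mul s t : seq (hmod_amod C) :=
  [seq (u : C) * (v : C) | u <- s, v <- t].

(** If V is the A-span of s, the words of length n span V^n, and V^0 is the image of A. *)
Fixpoint words s n : seq (hmod_amod C) :=
  if n is n'.+1 then seq_mul s (words s n') else [:: (1 : C)].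

Lemma aspan_bilin s t (N : C -> Prop) :
  is_submod (M := hmod_amod C) (fun=> True) N ->
  (forall u v, u \in s -> v \in t -> N ((u : C) * (v : C))) ->
  forall x y, aspan s x -> aspan t y -> N (x * y).
Proof.
move=> Nm stN x y + ty; elim=> {x} [_ ->|a u x _ us _ IH].
  by rewrite mul0r; apply: (submod0 Nm).
rewrite mulrDl; apply: (submodD Nm) => //.
rewrite halg_scaleE -mulrA -halg_scaleE; apply: (submodZ Nm) => //.
elim: ty => {y IH} [_ ->|b v y _ vt _ IH].
  by rewrite mulr0; apply: (submod0 Nm).
rewrite mulrDr; apply: (submodD Nm) => //.
rewrite halg_scaleE mulrCA -halg_scaleE; apply: (submodZ Nm) => //.
exact: stN.
Qed.

Lemma aspan_mul s t x y : aspan s x -> aspan t y -> aspan (seq_mul s t) (x * y).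
Proof.
apply: aspan_bilin; first exact: lspan_submod.
by move=> u v us vt; apply: mem_lspan; apply/allpairsP; exists (u, v).
Qed.

Lemma aspan_words_mul s m n x y : aspan (words s m) x -> aspan (words s n) y ->
  aspan (words s (m + n)) (x * y).
Proof.
apply: aspan_bilin; first exact: lspan_submod.
elim: m => [|m IH] u v.
  by rewrite inE => /eqP-> ?; rewrite mul1r; apply: mem_lspan.
move=> /allpairsP[[u1 u2] [/= us1 us2 ->]] vs; rewrite -mulrA.
by apply: aspan_mul; [apply: mem_lspan|apply: IH].
Qed.

Lemma words_hact_closed s n :
  hact_closed (aspan s) -> hact_closed (aspan (words s n)).
Proof.
move=> s_cl; elim: n => [|n IH]; apply: aspan_hact_closed => h x.
  rewrite inE => /eqP->; have -> : (1 : C) = alg_in (1 : A) by rewrite rmorph1.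
  rewrite hact_unit mulr1 -[alg_in _]mulr1 -halg_scaleE.
  apply: (submodZ (lspan_submod _)) => //; apply: mem_lspan.
  exact: mem_head.
move=> /allpairsP[[u v] [/= us vs ->]]; rewrite hactM.
apply: (submod_sum (lspan_submod _)) => -[g g'] _ /=.
by apply: aspan_mul; [apply: s_cl|apply: IH]; apply: mem_lspan.
Qed.

Lemma aspan_words0 x : aspan [:: (1 : C)] x -> exists a : A, x = alg_in a.
Proof.
elim=> {x} [_ ->|a u x _ + _ [b ->]]; first by exists 0; rewrite rmorph0.
rewrite inE => /eqP->; exists (a + b).
by rewrite halg_scaleE mulr1 rmorphD.
Qed.

Section Filtration.
Variable s : seq (hmod_amod C).
Hypothesis s_cl : hact_closed (aspan s).

Definition gen_filtration : filtration C :=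
  @Filtration A H C (fun n => aspan (words s n))
    (fun n => submod0 (M := hmod_amod C) (lspan_submod _))
    (fun n => submodB (M := hmod_amod C) (trueP_subring A) (lspan_submod _))
    (fun n => @words_hact_closed s n s_cl)
    (mem_lspan (mem_head _ _))
    (fun m n x y => @aspan_words_mul s m n x y).

Lemma gen_filtration1 x : aspan s x -> gen_filtration 1 x.
Proof.
move=> sx; rewrite -[x]mulr1; apply: aspan_mul => //.
exact/mem_lspan/mem_head.
Qed.

(** As 1 lies in V, the powers V^n increase. Their union is then a subalgebra, and it contains the
    generators of C. *)
Lemma gen_filtration_exhaustive t : aspan s 1 -> (forall x, x \in t -> aspan s x) ->
  (forall x, gen_subalg (alg_in : {rmorphism A -> C}) t x) ->
  forall x, exists n, gen_filtration n x.
Proof.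
move=> s1 ts tC x.
have mono m n y : (m <= n)%N -> gen_filtration m y -> gen_filtration n y.
  move=> /subnK<- Fy; elim: (n - m)%N => // k IH.
  by rewrite -[y]mul1r; apply: (filM (gen_filtration1 s1) IH).
elim: (tC x) => {x} [a|x /ts sx|x y _ [m Fx] _ [n Fy]|x y _ [m Fx] _ [n Fy]].
- by exists 0%N; apply: fil_alg_in.
- by exists 1%N; apply: gen_filtration1.
- exists (maxn m n); apply: filB.
    exact: mono (leq_maxl _ _) Fx.
  exact: mono (leq_maxr _ _) Fy.
- by exists (m + n)%N; apply: filM.
Qed.

Variable nz : (1 : C) != 0.
Local Notation rees := (rees nz gen_filtration).
Local Notation rspan := (lspan : seq (hmod_amod rees) -> rees -> Prop).

(* The map x |-> x t^n, defined on the degree n part of the filtration, is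
   A-linear; its values lie in N as soon as they do on the words of length n. *)
Lemma rmono_min n (N : rees -> Prop) :
  is_submod (M := hmod_amod rees) (fun=> True) N ->
  (forall u (Fu : gen_filtration n u), u \in words s n -> N (rmono nz Fu)) ->
  forall x (Fx : gen_filtration n x), N (rmono nz Fx).
Proof.
move=> Nm wN x Fx; have := Fx.
(* Because [rmono] takes a membership proof as argument, the induction on the span must allow every
   such proof. *)
suff gen y : aspan (words s n) y -> forall Fy : gen_filtration n y, N (rmono nz Fy).
  by move=> /gen.
elim=> {x Fx y} [_ ->|a u x _ us Fx IH] Fy.
  have -> : rmono nz Fy = 0.
    by apply: rees_eq => j; rewrite coef_rmono coef_rees0 if_same.
  exact: (submod0 Nm).
have {}Fx : gen_filtration n x := Fx.
have Fu : gen_filtration n u by apply: mem_lspan.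
have -> : rmono nz Fy = (a *: (rmono nz Fu : hmod_amod rees) : rees) + rmono nz Fx.
  apply: rees_eq => j; rewrite coefD coef_reesZ !coef_rmono.
  by case: eqP => _; [rewrite halg_scaleE|rewrite mulr0 addr0].
apply: (submodD Nm); last exact: IH.
by apply: (submodZ Nm) => //; apply: wN.
Qed.

Let homog n (y : rees) := exists x (Fx : gen_filtration n x), y = rmono nz Fx.

Let homog_span n : exists L : seq (hmod_amod rees),
  (forall x (Fx : gen_filtration n x), rspan L (rmono nz Fx)) /\
  (forall y, y \in L -> homog n y).
Proof.
have [|L [wL Lw]] := @seq_exists (hmod_amod C) (hmod_amod rees) (fun u y =>
    exists Fu : gen_filtration n u, y = rmono nz Fu) (words s n).
  move=> u us; have Fu : gen_filtration n u by apply: mem_lspan.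
  by exists (rmono nz Fu), Fu.
exists L; split=> [x Fx|y /Lw[u _ [Fu ->]]]; last by exists u, Fu.
apply: (rmono_min (lspan_submod L)) Fx => u Fu /wL[y yL [Fu' yE]].
rewrite (rmono_eq nz Fu Fu' erefl erefl) -yE.
exact: mem_lspan.
Qed.

(** Every element lies in a finite sum of the homogeneous pieces V^i t^i, and each piece is stable
    and finitely generated over A. *)
Lemma rees_locally_finite : locally_finite rees.
Proof.
apply: elementwise_locally_finite => p.
have [L LP] := choice homog_span.
pose N := (size (rees_val p)).+1.
pose Ls : seq (hmod_amod rees) := flatten [seq L i | i <- iota 0 N].
have homogP i (y : rees) : (i < N)%N -> homog i y -> rspan Ls y.
  move=> iN [x [Fx ->]].
  apply: spanmod_sub ((LP i).1 _ Fx) => // z zL.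
  by apply/flatten_mapP; exists i; rewrite ?mem_iota.
exists Ls; split.
  have -> : p = \sum_(i < N) rees_hc i p.
    apply: rees_eq => j; rewrite coef_rees_sum.
    under eq_bigr do rewrite coef_rees_hc.
    have [jN|le_Nj] := ltnP j N.
      rewrite (bigD1 (Ordinal jN)) //= eqxx big1 ?addr0 // => i.
      by rewrite -val_eqE /= eq_sym => /negPf->.
    rewrite nth_default ?(ltnW le_Nj) // big1 // => i _.
    by rewrite gtn_eqF // (leq_trans (ltn_ord i)).
  apply: (submod_sum (M := hmod_amod rees) (lspan_submod Ls)) => i _.
  by apply: (homogP i) => //; exists (rees_val p)`_i, (rees_coef p i).
apply: aspan_hact_closed => h y /flatten_mapP[i].
rewrite mem_iota => /andP[_ iN] /(LP i).2[x [Fx ->]].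
apply: (homogP i) => //.
by rewrite rmono_hact; exists (hact h x), (fil_hact h Fx).
Qed.

(** Generators over R are those of A together with the elements u t for u in s: a word of length i +
    1 placed in degree i + 1 is the product of some u t and a word of length i placed in degree
    i. *)
Lemma rees_finite_type (R : comPzRingType) (phi : {rmorphism R -> A}) :
  finite_type phi -> finite_type (alg_in \o phi : {rmorphism R -> rees}).
Proof.
move=> [sA sAP].
have [|T [sT _]] := @seq_exists (hmod_amod C) rees (fun u y =>
    exists Fu : gen_filtration 1 u, y = rmono nz Fu) s.
  move=> u us; have Fu : gen_filtration 1 u by apply/gen_filtration1/mem_lspan.
  by exists (rmono nz Fu), Fu.
pose G := [seq (alg_in a : rees) | a <- sA] ++ T.
have Gr := gen_subring (alg_in \o phi : {rmorphism R -> rees}) G.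
have Ga a : gen_subalg (alg_in \o phi : {rmorphism R -> rees}) G (alg_in a).
  by apply: gen_rmorph (sAP a) => y yA; rewrite mem_cat yA.
have Gm : is_submod (M := hmod_amod rees) (fun=> True)
    (gen_subalg (alg_in \o phi : {rmorphism R -> rees}) G).
  split=> [|x y|a x _ Gx]; first exact: (subring0 Gr).
    exact: (subringD Gr).
  by rewrite halg_scaleE; apply: gen_mul.
exists G => p; have [N ->] := rees_hc_sum p.
apply: (subring_sum Gr) => i _.
move: (nat_of_ord i) => {N}i; rewrite /rees_hc.
apply: rmono_min => // {p}.
elim: i => [|i IH] u Fu.
  rewrite inE => /eqP u1; have -> : rmono nz Fu = 1.
    by apply: rees_eq => j; rewrite coef_rmono u1 coef1; case: eqP.
  exact: (subring1 Gr).
move=> /allpairsP[[u1 u2] [/= us1 us2 uE]].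
have [y yT [Fu1 yE]] := sT _ us1.
have Fu2 : gen_filtration i u2 by apply: mem_lspan.
rewrite (rmono_eq nz Fu (filM Fu1 Fu2)) // -rmonoM -yE.
by apply: gen_mul; [apply: gen_mem; rewrite mem_cat yT orbT|apply: IH].
Qed.

(** The graded theorem is applied to the Rees algebra and the coefficientwise extension of J.
    Adequacy enters through the local finiteness of the Rees algebra, and evaluation at t = 1
    carries the result to C. *)
Lemma invariants_fg_mod (R : comPzRingType) (phi : {rmorphism R -> A})
    t (J : C -> Prop) :
  noetherian R -> finite_type phi -> adequate H ->
  aspan s 1 -> (forall x, x \in t -> aspan s x) ->
  (forall x, gen_subalg (alg_in : {rmorphism A -> C}) t x) ->
  T_stable (@defect A H C) J ->
  fg_mod (alg_in \o phi : {rmorphism R -> C}) (inv_mod (@defect A H C) J) J.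
Proof.
move=> nR phi_ft adH s1 ts tC Jst; have [sA sAP] := phi_ft.
apply: (rees_fg_mod (nz := nz) (F := gen_filtration)) => //.
  exact: gen_filtration_exhaustive s1 ts tC.
apply: (graded_invariants_fg (T := @defect A H rees) (hc := @rees_hc A H C nz _)
  (s0 := [seq (alg_in a : rees) | a <- sA])) => //.
- exact: rees_finite_type.
- exact: defectB.
- by move=> h r; apply: defect_unit.
- exact: defect_leibniz.
- by apply: adequate_power => //; apply: rees_locally_finite.
- exact: rees_hcB.
- exact: rees_hc_hc.
- exact: rees_hcM.
- exact: rees_hc_sum.
- by move=> n r; apply: rees_hc_alg_in.
- exact: rees_hc_defect.
- by move=> _ /mapP[a _ ->] h; apply: defect_unit.
(* The coefficient of degree 0 lies in the A-span of 1, so it comes from A and is generated over R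
   by [sA]. *)
- move=> p; have [a pa] := aspan_words0 (rees_coef p 0).
  have -> : rees_hc 0 p = alg_in a.
    by apply: rees_eq => j; rewrite coef_rees_hc coef_rees_alg_in pa.
  exact: gen_rmorph (sAP a).
- exact: rees_ideal_stable.
- exact: rees_ideal_graded.
Qed.

End Filtration.

Lemma locally_finite_span (t : seq C) : locally_finite C ->
  exists s : seq (hmod_amod C), [/\ hact_closed (aspan s) &
    forall x, x \in t -> aspan s x].
Proof.
move=> /locally_finite_elementwise Cfin; elim: t => [|x t [s [s_cl ts]]].
  by exists [::]; split=> //; apply: aspan_hact_closed.
have [s' [s'x s'_cl]] := Cfin x.
have subl : {subset s' <= s' ++ s} by move=> y ys; rewrite mem_cat ys.
have subr : {subset s <= s' ++ s} by move=> y ys; rewrite mem_cat ys orbT.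
exists (s' ++ s); split.
  apply: aspan_hact_closed => h y; rewrite mem_cat => /orP[/mem_lspan/(s'_cl h)|
    /mem_lspan/(s_cl h)]; exact: spanmod_sub.
move=> y; rewrite in_cons => /predU1P[->|/ts]; last exact: spanmod_sub.
exact: spanmod_sub s'x.
Qed.

End GeneratedFiltration.

(** * Invariants of modules *)

Section CModuleTheory.
Variables (A : comPzRingType) (H : bialgebra A) (C : hAlgType H) (M : cModType C).

Lemma cmod_scaleE (a : A) (m : hmod_amod M) : a *: m = (alg_in a : C) *: (m : M).
Proof. exact: hact_alg_in_scale. Qed.

(** As m is invariant, h(cm) = sum (h' c)(h'' m) = sum (h' c) eps(h'') m, and the right counit law
    sums h' eps(h'') to h. *)
Lemma hact_scale_invariant h (c : C) (m : M) :
  m \in is_invariant M -> hact h (c *: m) = hact h c *: m.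
Proof.
move=> /invariantP m_inv.
have scale_bal :
    balanced (fun (c : hmod_amod C) (m : hmod_amod M) => (c : C) *: (m : M)).
  split=> [x y z|x y z|a x y]; rewrite ?scalerDl ?scalerDr //.
  by rewrite cmod_scaleE halg_scaleE scalerA (alg_in_comm a (x : C)).
have act_bal : balanced (fun g g' : alg_amod H =>
    hact (g : H) c *: hact (g' : H) m).
  split=> [g k g'|g g' k|a g g'].
  - by rewrite hactDl scalerDl.
  - by rewrite hactDl scalerDr.
  - by rewrite !hactZl cmod_scaleE halg_scaleE scalerA (alg_in_comm a).
have eps_bal : balanced (fun g g' : alg_amod H => eps H g' *: g).
  split=> [g k g'|g g' k|a g g']; rewrite ?rmorphD ?scalerDl ?scalerDr //.
  have -> : eps H (a *: g' : alg_amod H) = a * eps H g' by rewrite rmorphM eps_in.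
  by rewrite scalerA mulrC.
have [_ /(_ h ((c : hmod_amod C) \ot (m : hmod_amod M)))] := @scale_hlinear A H C M.
rewrite [X in _ = hact h X -> _](tlift_pure scale_bal) => <-.
rewrite [hact h _]/(tens_act h _) /tens_act.
rewrite -[h in RHS](eps_counitr (h : alg_amod H)).
elim/tens_ind: (delta H h) => [|g g' x IH].
  by rewrite tens_act2_0x !tlift0 // hact0l scale0r.
rewrite tens_act2Dl !tliftD // IH tens_act2_pure !tlift_pure // hactDl scalerDl.
congr (_ + _); rewrite m_inv hactZl cmod_scaleE halg_scaleE scalerA.
by rewrite -(alg_in_comm (eps H g')).
Qed.

End CModuleTheory.

(** * Finite generation of C^H and finiteness of M^H *)

Section Main.
Variables (R A : comPzRingType) (phi : {rmorphism R -> A}).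
Variables (H : bialgebra A) (C : comHAlgType H).
Hypotheses (nR : noetherian R) (phi_ft : finite_type phi) (adH : adequate H).
Hypotheses (C_ft : finite_type (alg_in : {rmorphism A -> C})).
Hypothesis lfC : locally_finite C.

Local Notation psi := (alg_in \o phi : {rmorphism R -> C}).
Local Notation Cinv := (fun c : C => is_true (c \in is_invariant C)).

Lemma adequate_invariants_fg (J : C -> Prop) : T_stable (@defect A H C) J ->
  fg_mod psi (inv_mod (@defect A H C) J) J.
Proof.
move=> Jst; have [nz|/negbNE/eqP z] := boolP ((1 : C) != 0); last first.
  (* The zero ring is treated apart, since the Rees algebra is built inside polynomials over a
     nonzero ring. *)
  have C0 (b : C) : b = 0 by rewrite -[b]mul1r z mul0r.
  exists [::] => // b _; exists 0; first exact: (subring0 (gen_subring _ _)).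
  by rewrite (C0 (b - 0)); apply: ideal0 Jst.1.
have [t tC] := C_ft.
(* Adding 1 to the generators puts 1 in V, which makes the filtration exhaustive. *)
have [s [s_cl ts]] := locally_finite_span (1 :: t) lfC.
apply: (invariants_fg_mod s_cl nz nR phi_ft adH _ _ tC Jst).
  exact/ts/mem_head.
by move=> x xt; apply: ts; rewrite in_cons xt orbT.
Qed.

Let zero_stable : T_stable (@defect A H C) (fun c => c = 0).
Proof.
split; last by move=> h _ ->; rewrite /defect hact0 mulr0 subrr.
by split=> // [x y -> ->|r x ->]; rewrite ?addr0 ?mulr0.
Qed.

Lemma C_noeth : noeth_subring (fun _ : C => True).
Proof.
have [sA sAP] := phi_ft; have [t tC] := C_ft.
apply: (finite_type_noeth (f := psi)) nR _.
exists ([seq alg_in a | a <- sA] ++ t) => c.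
elim: (tC c) => {c} [a|x xt|x y _ gx _ gy|x y _ gx _ gy].
- by apply: gen_rmorph (sAP a) => y yA; rewrite mem_cat yA.
- by apply: gen_mem; rewrite mem_cat xt orbT.
- exact: gen_sub.
- exact: gen_mul.
Qed.

Lemma invariants_gen : exists2 s : seq C, forall x, x \in s -> Cinv x &
  forall c, Cinv c -> gen_subalg psi s c.
Proof.
have [s sI sg] := adequate_invariants_fg zero_stable.
exists s => [x /sI|c /invariant_defect/sg[c' gc' /subr0_eq->//]].
exact: (invariant_defect _).2.
Qed.

Lemma invariants_subring : is_subring Cinv.
Proof. exact: invariant_subring_closed. Qed.

Lemma invariants_noeth : noeth_subring Cinv.
Proof.
have [s sI sg] := invariants_gen.
have -> : Cinv = gen_subalg psi s.
  apply/funext => c; apply/propext; split; first exact: sg.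
  apply: (gen_min (S := Cinv) invariants_subring) => // r.
  by apply: invariant_alg_in.
exact: gen_noeth.
Qed.

Lemma invariants_finite_type :
  finite_type (inv_alg_in C \o phi : {rmorphism R -> invariants C}).
Proof.
have [s sI sg] := invariants_gen.
have [|S [sS _]] := @seq_exists _ (invariants C) (fun x y => inv_val y = x) s.
  by move=> x /sI xI; exists (Invariant xI).
exists S => b.
suff [b' gb' /val_inj<-//] : exists2 b', gen_subalg
    (inv_alg_in C \o phi : {rmorphism R -> invariants C}) S b' &
    inv_val b' = inv_val b.
elim: (sg _ (inv_valP b)) => [r|x /sS[y yS yx]|x y _ [x' gx x'x] _ [y' gy y'y]|
    x y _ [x' gx x'x] _ [y' gy y'y]].
- by exists (inv_alg_in C (phi r)) => //; apply: (gen_scalar _ _ r).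
- by exists y => //; apply: gen_mem.
- by exists (x' - y'); [apply: gen_sub|rewrite /= x'x y'y].
- by exists (x' * y'); [apply: gen_mul|rewrite /= x'x y'y].
Qed.

Section Modules.
Variable M : cModType C.
Local Notation Minv := (fun m : M => is_true (m \in is_invariant M)).
Local Notation cspan := (@spanmod C (M : lmodType C) (fun=> True) (fun v => v = 0)).

Lemma Minv_submod : is_submod (M := (M : lmodType C)) Cinv Minv.
Proof.
have [M0 MB] := invariant_zmod_closed M.
split=> // [u v Mu Mv|c v Cc Mv]; last exact: invariant_scale.
by rewrite -[v]opprK -[- v]sub0r; apply: (MB) => //; apply: (MB).
Qed.

Lemma cspan_hact_closed ms : (forall m, m \in ms -> Minv m) -> hact_closed (cspan ms).
Proof.
move=> msI h v; elim=> {v} [_ ->|c m v _ mms _ IH].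
  by rewrite hact0; apply: (submod0 (lspan_submod _)).
rewrite hactDr hact_scale_invariant; last exact: msI.
by apply: spanmod_step.
Qed.

(** Induction on ms. With N the C-span of ms, adjoining m gives a quotient isomorphic to C/J, and an
    invariant v congruent to c m modulo N has c invariant modulo J. Such c form a finite module over
    a subalgebra of C^H modulo J; invariants lying in N are covered by induction. *)
Lemma Minv_span_fg ms : (forall m, m \in ms -> Minv m) ->
  exists2 l, forall x, x \in l -> Minv x &
    forall v, Minv v -> cspan ms v ->
      @spanmod C (M : lmodType C) Cinv (fun v => v = 0) l v.
Proof.
elim: ms => [_|m ms IH msI].
  by exists [::] => // v _; case=> // u ->; apply: spanmod_base.
have mI : Minv m by apply/msI/mem_head.
have {}msI x : x \in ms -> Minv x by move=> xms; apply: msI; rewrite in_cons xms orbT.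
have [l2 l2I sl2] := IH msI.
have ms_cl := cspan_hact_closed msI.
have Nm := lspan_submod (ms : seq (M : lmodType C)).
have NS : is_submod (M := (M : lmodType C)) Cinv (cspan ms).
  by case: Nm => N0 ND NZ; split=> // c v _; apply: NZ.
(* [J] is the annihilator of the class of m modulo the span of ms; it is stable because h(cm) = (hc)
   m. *)
pose J c := cspan ms (c *: m).
have Jst : T_stable (@defect A H C) J.
  apply/T_stable_hact; split=> [|h c Jc]; last first.
    by rewrite /J -hact_scale_invariant //; apply: ms_cl.
  split=> [|x y Jx Jy|r x Jx]; rewrite /J.
  - by rewrite scale0r; apply: (submod0 Nm).
  - by rewrite scalerDl; apply: (submodD Nm).
  - by rewrite -scalerA; apply: (submodZ Nm).
have Jr := inv_mod_subring (psi := psi) (@defectB A H C)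
  (fun h r => defect_unit C h (phi r)) (@defect_leibniz A H C) Jst.
have [gs [l [gsI lI sl]]] := finite_mod_integral (psi := psi)
  (G := inv_mod (@defect A H C) (fun b => b = 0)) nR Jst.1 Jr (fun b Ib => Ib)
  (fun b b0 h => eq_ind_r J (ideal0 Jst.1) (b0 h))
  (fun r h => defect_unit C h (phi r)) (adequate_invariants_fg Jst)
  (adequate_power adH lfC Jst).
(* [W] is finitely generated over C^H modulo the span of ms and will contain all invariants in
   question. As C^H is noetherian, these invariants are themselves finitely generated modulo that
   span. *)
pose W := @spanmod C (M : lmodType C) Cinv (cspan ms) [seq c *: m | c <- l].
have Wm : is_submod (M := (M : lmodType C)) Cinv W.
  by apply: spanmod_submod => //; apply: invariants_subring.
have [nW] := noeth_span [seq c *: m | c <- l] invariants_subring NS invariants_noeth.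
have [||l1 l1P sl1] := nW (fun v : M => Minv v /\ cspan (m :: ms) v).
- apply: submodI; first exact: Minv_submod.
  by have [N0 ND NZ] := lspan_submod (m :: ms : seq (M : lmodType C));
    split=> // c v _; apply: NZ.
- move=> v [vI].
  have spanE u : cspan (m :: ms) u -> exists c, cspan ms (u - c *: m).
    elim=> {u} [_ ->|c x u _ + _ [d Nd]].
      by exists 0; rewrite scale0r subr0; apply: (submod0 Nm).
    rewrite in_cons => /predU1P[->|xms].
      by exists (c + d); rewrite scalerDl opprD addrACA subrr add0r.
    by exists d; rewrite -addrA; apply: spanmod_step.
  move=> /spanE[c Nc].
  (* The defect of c times m equals h(cm) - eps(h) cm. Writing cm = v - (v - cm), the contribution
     of the invariant v vanishes and that of v - cm stays in the stable span of ms. *)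
  have cJ : inv_mod (@defect A H C) J c.
    move=> h; rewrite /J /defect scalerBl -hact_scale_invariant // -scalerA.
    have -> : c *: m = v - (v - c *: m) by rewrite opprB addrC subrK.
    move/invariantP: vI => vI.
    rewrite hactB vI cmod_scaleE scalerBr opprB addrC addrA subrK.
    by apply: (submodB _ Nm) => //; [apply: (submodZ Nm)|apply: ms_cl].
  rewrite -(subrK (c *: m) v); apply: (submodD Wm); first exact: spanmod_base.
  elim: (sl _ cJ) => {c Nc cJ} [c [_ Jc]|d x c gd xl _ Wc]; first exact: spanmod_base.
  rewrite scalerDl; apply: (submodD Wm) => //.
  rewrite -[d *: x]/(d * x) -scalerA; apply: (submodZ Wm).
    apply: (gen_min (S := Cinv) invariants_subring) gd => [r|y /gsI yI].
      exact: invariant_alg_in.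
    exact: (invariant_defect _).2.
  apply: spanmod_mem; [exact: invariants_subring|exact: NS|].
  by apply: (map_f (fun c => c *: m)).
exists (l1 ++ l2) => [x|v vI vms].
  by rewrite mem_cat => /orP[/l1P[]|/l2I].
have Sm := spanmod_submod (l1 ++ l2) invariants_subring
  (submod_zero (M : lmodType C) Cinv).
apply: spanmod_min (sl1 v (conj vI vms)) => // [u [[uI _] uN]|x xl1].
  by apply: spanmod_sub (sl2 u uI uN) => // x xl2; rewrite mem_cat xl2 orbT.
apply: spanmod_mem; [exact: invariants_subring|exact: submod_zero|].
by rewrite mem_cat xl1.
Qed.

(* M need not be locally finite, but C M^H, which has the same invariants, is
   generated by invariants. *)
Lemma invariants_finite_module :
  finite_module (B := C) M -> finite_module (B := invariants C) (invariants M).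
Proof.
move=> M_fin.
have [s sM] := (finite_moduleP (M : lmodType C)).1 M_fin.
have [nM] := noeth_span s (trueP_subring C) (submod_zero (M : lmodType C) _) C_noeth.
(* [P] is C M^H; concatenating lists of invariants shows that it is closed under sums. It is
   finitely generated over C because M is noetherian. *)
pose P (v : M) := exists2 ms, forall m, m \in ms -> Minv m & cspan ms v.
have P_cat ms v w : (forall m, m \in ms -> Minv m) -> cspan ms v -> P w ->
    exists ms', [/\ forall m, m \in ms' -> Minv m, cspan ms' v & cspan ms' w].
  move=> msI msv [ms' ms'I ms'w]; exists (ms ++ ms'); split=> [m||].
  - by rewrite mem_cat => /orP[/msI|/ms'I].
  - by apply: spanmod_sub msv => // x xms; rewrite mem_cat xms.
  - by apply: spanmod_sub ms'w => // x xms; rewrite mem_cat xms orbT.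
have [||l lP sl] := nM P.
- split=> [|u v [ms msI msu] vP|c v _ [ms msI msv]].
  + by exists [::] => //; apply: spanmod_base.
  + have [ms' [ms'I ms'u ms'v]] := P_cat _ _ _ msI msu vP.
    by exists ms' => //; apply: (submodD (lspan_submod _)).
  + by exists ms => //; apply: (submodZ (lspan_submod _)).
- by move=> v _; apply: sM.
(* Each of the finitely many generators of C M^H involves only finitely many invariants, and all of
   these together form [ms]. *)
have [ms msI lms] : exists2 ms, forall m, m \in ms -> Minv m &
    forall x, x \in l -> cspan ms x.
  elim: l lP {sl} => [|x l IH] lP; first by exists [::].
  have [y yl|ms msI lms] := IH; first by apply: lP; rewrite in_cons yl orbT.
  have [ms' ms'I ms'x] := lP x (mem_head _ _).
  exists (ms ++ ms') => [m|y]; first by rewrite mem_cat => /orP[/msI|/ms'I].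
  rewrite in_cons => /predU1P[->|/lms msy].
    by apply: spanmod_sub ms'x => // z zms; rewrite mem_cat zms orbT.
  by apply: spanmod_sub msy => // z zms; rewrite mem_cat zms.
have Mms v : Minv v -> cspan ms v.
  move=> vI; have /sl : P v.
    by exists [:: v]; [move=> m; rewrite inE => /eqP->|apply/mem_lspan/mem_head].
  by apply: spanmod_min => // [|u [_ ->]]; [|apply: submod0]; apply: lspan_submod.
have [l' l'I sl'] := Minv_span_fg msI.
have [|L [l'L _]] := @seq_exists _ (invariants M) (fun x y => inv_val y = x) l'.
  by move=> x /l'I xI; exists (Invariant xI).
apply/finite_moduleP; exists L => v.
suff [w Lw /val_inj<-//] : exists2 w, lspan (L : seq (invariants M)) w &
    inv_val w = inv_val v.
elim: (sl' _ (inv_valP v) (Mms _ (inv_valP v))) =>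
    [_ ->|c x u cI /l'L[y yL yx] _ [w Lw wu]].
  by exists 0 => //; apply: (submod0 (lspan_submod _)).
exists ((Invariant cI : invariants C) *: y + w); last by rewrite /= yx wu.
apply: (submodD (lspan_submod _)) => //.
by apply: (submodZ (lspan_submod _)) => //; apply: mem_lspan.
Qed.

End Modules.
End Main.

Theorem corollary16p3 (R A : comPzRingType) (phi : {rmorphism R -> A})
    (H : bialgebra A) (C : comHAlgType H) :
  noetherian R -> finite_type phi -> adequate H ->
  finite_type (alg_in : {rmorphism A -> C}) -> locally_finite C ->
  finite_type (inv_alg_in C \o phi : {rmorphism R -> invariants C}) /\
  forall M : cModType C,
    finite_module (B := C) M -> finite_module (B := invariants C) (invariants M).
Proof.
move=> nR phi_ft adH C_ft lfC; split; first exact: invariants_finite_type.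
by move=> M; apply: (invariants_finite_module nR phi_ft).
Qed.
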